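(* Let $k\ge 1$ be an integer, let $\mathrm{DM}\in\{tw_k,hw_k\}$, let $\mathbb{A}$ be a connected left-hand structure with universe $A$, let $\mathbb{A}_{\mathcal V}=\ell\text{-DM}(\mathbb{A})$ with vocabulary $\tau_{\mathcal V}$, and let $O\subseteq A$ be a set of variables. The following are equivalent: (1) $O$ is tp-covered in $\mathbb{A}_{\mathcal V}$; (2) for every right-hand structure $\mathbb{B}$, and for every relation symbol $R\in\tau_{\mathcal V}$ with $O\subseteq\mathrm{var}(R^{\mathbb{A}_{\mathcal V}})$, one has $R^{\mathrm{GAC}(\mathbb{A}_{\mathcal V},\mathbb{B}_{\mathcal V})}[O]=\mathbb{A}^{\mathbb{B}}[O]$, where $\mathbb{B}_{\mathcal V}=r\text{-DM}(\mathbb{A},\mathbb{B})$.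
   Context: **Structures and homomorphisms.** All structures are finite. A vocabulary $\tau$ is a finite set of relation symbols with arities. A relational structure $\mathbb{A}$ over $\tau$ has a universe $A$ (whose elements are called variables when $\mathbb{A}$ is the left-hand structure) and a relation $R^{\mathbb{A}}\subseteq A^r$ for each $r$-ary $R\in\tau$. A CSP instance is a pair $(\mathbb{A},\mathbb{B})$ of structures over the same vocabulary ($\mathbb{A}$ left-hand, $\mathbb{B}$ right-hand); a constraint is given by a symbol $R$ and a tuple $t\in R^{\mathbb{A}}$ (its scope), with relation $R^{\mathbb{B}}$. $\mathbb{A}^{\mathbb{B}}$ is the set of all homomorphisms from $\mathbb{A}$ to $\mathbb{B}$ (the solutions), and $\mathbb{A}^{\mathbb{B}}[X]$ is the set of their restrictions to $X\subseteq A$; for $X=\emptyset$ it is a one-element set (the value ''true'') if a homomorphism exists and is empty otherwise; the same convention applies to projections of relations on $\emptyset$. $\mathbb{A}\uplus\mathbb{A}'$ (disjoint vocabularies) is the structure over the union of the vocabularies whose universe and relations are the unions of those of $\mathbb{A}$ and $\mathbb{A}'$. $\mathbb{A}'$ is a substructure of $\mathbb{A}$ if $A'\subseteq A$ and $R^{\mathbb{A}'}\subseteq R^{\mathbb{A}}$ for every $R$ (not necessarily induced). $\mathbb{A}'$ is a core of $\mathbb{A}$ if it is a substructure of $\mathbb{A}$ such that there is a homomorphism from $\mathbb{A}$ to $\mathbb{A}'$ and no substructure $\mathbb{A}''$ of $\mathbb{A}'$ other than $\mathbb{A}'$ admits a homomorphism from $\mathbb{A}$ to $\mathbb{A}''$.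 **Hypergraphs and tree projections.** $\mathcal{H}_{\mathbb{A}}$ is the hypergraph with node set $A$ and, for each tuple in each relation of $\mathbb{A}$, a hyperedge consisting of the variables in the tuple. $\mathbb{A}$ is connected if $\mathcal{H}_{\mathbb{A}}$ is. A hypergraph is acyclic if it has a join tree: a tree whose vertices are its hyperedges such that, whenever a node $X$ occurs in two hyperedges, $X$ occurs in every vertex on the path linking them. $\mathcal{H}_1\le\mathcal{H}_2$ means every hyperedge of $\mathcal{H}_1$ is contained in some hyperedge of $\mathcal{H}_2$. A tree projection of $(\mathcal{H}_1,\mathcal{H}_2)$ is an acyclic hypergraph $\mathcal{H}_a$ with $\mathcal{H}_1\le\mathcal{H}_a\le\mathcal{H}_2$. **Views.** $\mathbb{A}_{\mathcal V}$ is a structure with universe $A$, over a vocabulary $\tau_{\mathcal V}$ disjoint from that of $\mathbb{A}$, in which every relation contains exactly one tuple; the set of variables in the tuple of $R\in\tau_{\mathcal V}$ is denoted $\mathrm{var}(R^{\mathbb{A}_{\mathcal V}})$. Symbols of $\tau_{\mathcal V}$ are called views. For every $R\in\tau$ and $t\in R^{\mathbb{A}}$ there is a base view $R_t\in\tau_{\mathcal V}$ with $R_t^{\mathbb{A}_{\mathcal V}}=\{t\}$. A relation $R^{\mathbb{B}_{\mathcal V}}$ of a right-hand structure $\mathbb{B}_{\mathcal V}$ over $\tau_{\mathcal V}$ is identified with the set of assignments $\mathrm{var}(R^{\mathbb{A}_{\mathcal V}})\to B$ mapping the tuple of $R^{\mathbb{A}_{\mathcal V}}$ into $R^{\mathbb{B}_{\mathcal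 V}}$; $R^{\mathbb{B}_{\mathcal V}}[O]$ is the set of restrictions of these assignments to $O$. For a right-hand structure named $\mathrm{GAC}(\mathbb{A}_{\mathcal V},\mathbb{B}_{\mathcal V})$ (defined below), $R^{\mathrm{GAC}(\mathbb{A}_{\mathcal V},\mathbb{B}_{\mathcal V})}$ is its relation for the view $R$. **The methods $hw_k$ and $tw_k$.** Each method DM gives a pair of functions: $\ell\text{-DM}(\mathbb{A})$ is the structure of views $\mathbb{A}_{\mathcal V}$ and $r\text{-DM}(\mathbb{A},\mathbb{B})$ is the right-hand structure $\mathbb{B}_{\mathcal V}$ over $\tau_{\mathcal V}$. For $hw_k$: for each nonempty set $\mathcal{C}$ of at most $k$ constraints of $(\mathbb{A},\mathbb{B})$ there is a view whose variables in $\ell\text{-}hw_k(\mathbb{A})$ are all variables occurring in $\mathcal{C}$ and whose relation in $r\text{-}hw_k(\mathbb{A},\mathbb{B})$ consists of all solutions of the subproblem formed by $\mathcal{C}$ (the single-constraint sets give the base views). For $tw_k$: for each nonempty set $S$ of at most $k+1$ variables there is a view with variable set $S$ in $\ell\text{-}tw_k(\mathbb{A})$ whose relation in $r\text{-}tw_k(\mathbb{A},\mathbb{B})$ consists of all assignments $S\to B$ satisfying all constraints with scope inside $S$; in addition there are the base views $R_t$, with relation $R^{\mathbb{B}}$. **GAC.** $\mathrm{GAC}(\mathbb{A}_{\mathcal V},\mathbb{B}_{\mathcal V})$ is the right-hand structure obtained from $\mathbb{B}_{\mathcal V}$ by enforcing generalized arc consistency: tuples are deleted from the relations until every two views $R,R'$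 having a nonempty set $\bar X$ of common variables agree on it, i.e. have the same projection on $\bar X$ (the largest such sub-structure). **tp-covered sets.** For $O=\{X_1,\dots,X_r\}$, $\mathbb{S}_O$ is the structure with universe $O$ and one fresh $r$-ary symbol $R_O$ whose relation is $\{\langle X_1,\dots,X_r\rangle\}$ (imposing nothing if $O=\emptyset$). $O$ is tp-covered in $\mathbb{A}_{\mathcal V}$ if there is a core $\mathbb{A}'$ of $\mathbb{A}\uplus\mathbb{S}_O$ such that $(\mathcal{H}_{\mathbb{A}'},\mathcal{H}_{\mathbb{A}_{\mathcal V}})$ has a tree projection.
   Formalization: The formal theorem assumes that, if O is nonempty, some view contains O (otherwise (2) holds vacuously while (1) fails), and that all relation symbols of the vocabulary have arity at least 1 (with nullary symbols the equivalence can fail). *)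

(* Defs.v *)
From mathcomp Require Import all_boot.

Set Implicit Arguments.
Unset Strict Implicit.
Unset Printing Implicit Defensive.

(** * Vocabularies, structures, homomorphisms *)

Record vocabulary := Vocabulary { symbol :> finType; arity : symbol -> nat }.

Definition fact (tau : vocabulary) (V : finType) : finType :=
  {R : tau & (arity R).-tuple V}.

Definition mkfact (tau : vocabulary) (V : finType) (R : tau)
  (t : (arity R).-tuple V) : fact tau V := existT _ R t.

Definition scope (tau : vocabulary) (V : finType) (f : fact tau V) : {set V} :=
  [set x in tagged f].

(** The universe is a subset of an ambient finite type [V], so that
    substructures of a structure, and structures sharing elements, live over the
    same [V].  The relations are given together, as the set of all pairs (R, t)
    with t in R^A: [facts A] is the set of constraints when [A] is a left-hand
    structure, and [interp A R] is R^A. *)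
Record structure (tau : vocabulary) (V : finType) := Structure {
  univ : {set V};
  facts : {set fact tau V};
  facts_univ : [forall f in facts, scope f \subset univ]
}.

Definition interp (tau : vocabulary) (V : finType) (A : structure tau V)
  (R : tau) : {set (arity R).-tuple V} := [set t | mkfact t \in facts A].

Definition substructure (tau : vocabulary) (V : finType)
  (A' A : structure tau V) : bool :=
  (univ A' \subset univ A) && (facts A' \subset facts A).

(** Partial maps; an assignment X -> W is one whose domain is exactly X. *)
Definition assignment (V W : finType) : finType := {ffun V -> option W}.

Definition dom (V W : finType) (h : assignment V W) : {set V} :=
  [set x | isSome (h x)].

Definition restrict (V W : finType) (X : {set V}) (h : assignment V W) :
  assignment V W := [ffun x => if x \in X then h x else None].

(** S[X]; for X empty this is a singleton if S is inhabited, and empty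
    otherwise. *)
Definition proj (V W : finType) (X : {set V}) (S : {set assignment V W}) :
  {set assignment V W} := [set restrict X h | h in S].

Definition maps (V W : finType) (h : assignment V W) (t : seq V) (u : seq W) :
  bool := [seq h x | x <- t] == [seq Some b | b <- u].

Definition satisfies (tau : vocabulary) (V W : finType) (B : structure tau W)
  (h : assignment V W) (f : fact tau V) : bool :=
  [exists u in interp B (tag f), maps h (tagged f) u].

(** Assignments X -> B satisfying all the constraints in C. *)
Definition solutions (tau : vocabulary) (V W : finType) (B : structure tau W)
  (X : {set V}) (C : {set fact tau V}) : {set assignment V W} :=
  [set h : assignment V W |
    [&& dom h == X,
        [forall x, forall b, (h x == Some b) ==> (b \in univ B)]
      & [forall f in C, satisfies B h f]]].

Definition homs (tau : vocabulary) (V W : finType) (A : structure tau V)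
  (B : structure tau W) : {set assignment V W} :=
  solutions B (univ A) (facts A).

Definition is_core (tau : vocabulary) (V : finType) (A' A : structure tau V) :
  Prop :=
  [/\ substructure A' A,
      exists h, h \in homs A A'
    & forall A'' : structure tau V, substructure A'' A' ->
        (exists h, h \in homs A A'') -> A'' = A'].

(** Tagging the symbols by [inl]/[inr] makes the vocabularies disjoint; the
    universes may overlap. *)
Definition voc_union (tau1 tau2 : vocabulary) : vocabulary :=
  @Vocabulary (tau1 + tau2)%type
    (fun R => match R with inl R1 => arity R1 | inr R2 => arity R2 end).

Definition union_facts (tau1 tau2 : vocabulary) (V : finType)
  (A1 : structure tau1 V) (A2 : structure tau2 V) :
  {set fact (voc_union tau1 tau2) V} :=
  [set f : fact (voc_union tau1 tau2) V |
    match f with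
    | existT (inl R) t => @mkfact tau1 V R t \in facts A1
    | existT (inr R) t => @mkfact tau2 V R t \in facts A2
    end].

Lemma scope_univ (tau : vocabulary) (V : finType) (A : structure tau V) f :
  f \in facts A -> scope f \subset univ A.
Proof. by move=> fA; have /forall_inP/(_ _ fA) := facts_univ A. Qed.

Lemma union_wf (tau1 tau2 : vocabulary) (V : finType)
  (A1 : structure tau1 V) (A2 : structure tau2 V) :
  [forall f in union_facts A1 A2, scope f \subset univ A1 :|: univ A2].
Proof.
apply/forall_inP => -[[R|R] t]; rewrite inE => /scope_univ/subset_trans; apply.
  exact: subsetUl.
exact: subsetUr.
Qed.

Definition str_union (tau1 tau2 : vocabulary) (V : finType)
  (A1 : structure tau1 V) (A2 : structure tau2 V) :
  structure (voc_union tau1 tau2) V := Structure (union_wf A1 A2).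

(** * Hypergraphs and tree projections *)

Record hypergraph (V : finType) := Hypergraph {
  nodes : {set V};
  hedges : {set {set V}};
  hedges_nodes : [forall h in hedges, h \subset nodes]
}.

Lemma hyp_wf (tau : vocabulary) (V : finType) (A : structure tau V) :
  [forall h in [set scope f | f in facts A], h \subset univ A].
Proof. by apply/forall_inP => _ /imsetP[f fA ->]; exact: scope_univ. Qed.

Definition hyp (tau : vocabulary) (V : finType) (A : structure tau V) :
  hypergraph V := Hypergraph (hyp_wf A).

Definition hyp_connected (V : finType) (H : hypergraph V) : Prop :=
  {in nodes H &, forall x y,
     connect (fun a b => [exists h in hedges H, (a \in h) && (b \in h)]) x y}.

Definition hyp_le (V : finType) (H1 H2 : hypergraph V) : Prop :=
  forall h1, h1 \in hedges H1 -> exists2 h2, h2 \in hedges H2 & h1 \subset h2.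

(** The simple graph with vertex set [E] and adjacency [e] is connected and has
    no cycle. The graph without vertices is allowed, so that a hypergraph without
    hyperedges is acyclic. *)
Definition is_tree (T : finType) (E : {set T}) (e : rel T) : Prop :=
  [/\ symmetric e,
      irreflexive e,
      forall x y, e x y -> (x \in E) && (y \in E),
      {in E &, forall x y, connect e x y}
    & forall c : seq T, 2 < size c -> ~~ (cycle e c && uniq c)].

Definition is_join_tree (V : finType) (H : hypergraph V) (e : rel {set V}) :
  Prop :=
  is_tree (hedges H) e /\
  forall (x : V) (h : {set V}) (p : seq {set V}),
    h \in hedges H -> x \in h -> path e h p -> uniq (h :: p) ->
    x \in last h p -> forall h', h' \in p -> x \in h'.

Definition acyclic (V : finType) (H : hypergraph V) : Prop :=
  exists e : rel {set V}, is_join_tree H e.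

Definition tree_projection (V : finType) (H1 H2 Ha : hypergraph V) : Prop :=
  [/\ acyclic Ha, hyp_le H1 Ha & hyp_le Ha H2].

(** * Views and generalized arc consistency *)

(** A structure of views has exactly one tuple per relation, so this is the set
    of variables of that tuple. *)
Definition view_vars (tauV : vocabulary) (V : finType) (AV : structure tauV V)
  (R : tauV) : {set V} := \bigcup_(t in interp AV R) [set x in t].

(** The relation R^BV seen as a set of assignments to the variables of R. *)
Definition view_rel (tauV : vocabulary) (V W : finType) (AV : structure tauV V)
  (BV : structure tauV W) (R : tauV) : {set assignment V W} :=
  [set h : assignment V W | (dom h == view_vars AV R) &&
    [forall t in interp AV R, [exists u in interp BV R, maps h t u]]].

Definition arc_consistent (tauV : vocabulary) (V W : finType)
  (AV : structure tauV V) (BV : structure tauV W) : bool :=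
  [forall R, forall R', let X := view_vars AV R :&: view_vars AV R' in
    (X != set0) ==>
    (proj X (view_rel AV BV R) == proj X (view_rel AV BV R'))].

Lemma prune_wf (tau : vocabulary) (V : finType) (B : structure tau V)
  (F : {set fact tau V}) :
  [forall f in facts B :&: F, scope f \subset univ B].
Proof. by apply/forall_inP => f /setIP[/scope_univ]. Qed.

Definition prune (tau : vocabulary) (V : finType) (B : structure tau V)
  (F : {set fact tau V}) : structure tau V := Structure (prune_wf B F).

(** The union of all arc consistent prunings of [BV]. It is itself arc
    consistent ([GAC_consistent]), hence the largest one. *)
Definition GAC (tauV : vocabulary) (V W : finType) (AV : structure tauV V)
  (BV : structure tauV W) : structure tauV W :=
  prune BV (\bigcup_(F | arc_consistent AV (prune BV F)) F).

Definition is_view_structure (tauV : vocabulary) (V : finType)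
  (AV : structure tauV V) : Prop :=
  forall R : tauV, exists t, interp AV R = [set t].

Lemma view_relE (tauV : vocabulary) (V W : finType) (AV : structure tauV V)
  (BV : structure tauV W) (R : tauV) t h :
  interp AV R = [set t] ->
  (h \in view_rel AV BV R) =
  (dom h == view_vars AV R) && [exists u in interp BV R, maps h t u].
Proof.
move=> Rt; rewrite inE; congr (_ && _); apply/forall_inP/idP.
  by apply; rewrite Rt inE.
by move=> ht t'; rewrite Rt inE => /eqP->.
Qed.

Lemma view_relS (tauV : vocabulary) (V W : finType) (AV : structure tauV V)
  (B1 B2 : structure tauV W) (R : tauV) :
  facts B1 \subset facts B2 -> view_rel AV B1 R \subset view_rel AV B2 R.
Proof.
move=> /subsetP B12; apply/subsetP => h; rewrite !inE => /andP[-> /forall_inP hR].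
apply/forall_inP => t /hR/exists_inP[u]; rewrite inE => /B12 uB tu.
by apply/exists_inP; exists u; rewrite ?inE.
Qed.

Lemma GAC_consistent (tauV : vocabulary) (V W : finType)
  (AV : structure tauV V) (BV : structure tauV W) :
  is_view_structure AV -> arc_consistent AV (GAC AV BV).
Proof.
move=> AVv; apply/forallP => R1; apply/forallP => R2; apply/implyP => X0.
suff sub R R' : view_vars AV R :&: view_vars AV R' != set0 ->
    proj (view_vars AV R :&: view_vars AV R') (view_rel AV (GAC AV BV) R)
    \subset
    proj (view_vars AV R :&: view_vars AV R') (view_rel AV (GAC AV BV) R').
  by rewrite eqEsubset sub //= setIC sub // setIC.
move=> {R1 R2}X0; apply/subsetP => _ /imsetP[h hR ->].
have [t Rt] := AVv R; move: hR; rewrite (view_relE _ _ Rt) => /andP[dh].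
case/exists_inP=> u; rewrite !inE => /andP[uB /bigcupP[F acF uF]] tu.
have hF : h \in view_rel AV (prune BV F) R.
  rewrite (view_relE _ _ Rt) dh; apply/exists_inP; exists u => //.
  by rewrite !inE uB.
have /forallP/(_ R)/forallP/(_ R')/implyP/(_ X0)/eqP E := acF.
have: restrict (view_vars AV R :&: view_vars AV R') h \in
    proj (view_vars AV R :&: view_vars AV R') (view_rel AV (prune BV F) R).
  exact: imset_f.
rewrite E => /imsetP[h' h'R ->]; apply: imset_f.
apply: (subsetP (view_relS _ _ _)) h'R.
by apply: setIS; apply: bigcup_sup.
Qed.

(** * tp-covered sets *)

Definition voc_O (V : finType) (O : {set V}) : vocabulary :=
  @Vocabulary unit (fun=> #|O|).

(** R_O is left empty for O empty: it must not create an empty hyperedge. *)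
Definition S_facts (V : finType) (O : {set V}) : {set fact (voc_O O) V} :=
  if O == set0 then set0 else [set @mkfact (voc_O O) V tt (enum_tuple O)].

Lemma S_wf (V : finType) (O : {set V}) :
  [forall f in S_facts O, scope f \subset O].
Proof.
apply/forall_inP => f; rewrite /S_facts; case: ifP => [_|_]; rewrite inE //.
by move=> /eqP->; apply/subsetP => x; rewrite inE /= mem_enum.
Qed.

Definition S_ (V : finType) (O : {set V}) : structure (voc_O O) V :=
  Structure (S_wf O).

Definition tp_covered (tau tauV : vocabulary) (V : finType)
  (A : structure tau V) (AV : structure tauV V) (O : {set V}) : Prop :=
  exists A', is_core A' (str_union A (S_ O)) /\
    exists Ha, tree_projection (hyp A') (hyp AV) Ha.

(** A nonempty O included in the variables of no view is never tp-covered, while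
    every condition quantified over the views that contain O holds for it
    vacuously. *)
Lemma tp_covered_view (tau tauV : vocabulary) (V : finType)
  (A : structure tau V) (AV : structure tauV V) (O : {set V}) :
  O != set0 -> tp_covered A AV O -> exists R, O \subset view_vars AV R.
Proof.
move=> O0 [A' [[/andP[_ /subsetP sA'] [h]]]].
rewrite inE => /and3P[_ _ /forall_inP hA] _ [Ha [_ le1 le2]].
pose R0 : voc_union tau (voc_O O) := inr tt.
pose t0 : (arity R0).-tuple V := enum_tuple O.
have f0 : mkfact t0 \in facts (str_union A (S_ O)).
  by rewrite inE /= /S_facts (negPf O0) inE eqxx.
have /exists_inP[u uA' _] := hA _ f0; rewrite inE in uA'.
have scu : scope (mkfact u) = O.
  have := sA' _ uA'; rewrite inE /= /S_facts (negPf O0) inE => /eqP E.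
  have: scope (@mkfact (voc_O O) V tt u) = O.
    by rewrite E; apply/setP => x; rewrite inE /= mem_enum.
  by [].
have [|h1 h1a Oh1] := le1 O; first by rewrite -{1}scu; apply: imset_f.
have [h2 /imsetP[[R t] fR ->] h12] := le2 _ h1a.
exists R; apply: subset_trans Oh1 (subset_trans h12 _).
apply/subsetP => x xt; apply/bigcupP; exists t; first by rewrite inE.
by rewrite inE in xt *.
Qed.

(** * The methods hw_k and tw_k *)

Record method := Method {
  voc_views : forall (tau : vocabulary) (V : finType),
    structure tau V -> vocabulary;
  lDM : forall (tau : vocabulary) (V : finType) (A : structure tau V),
    structure (voc_views A) V;
  rDM : forall (tau : vocabulary) (V W : finType) (A : structure tau V),
    structure tau W -> structure (voc_views A) W
}.

Section Methods.
Variables (k : nat) (tau : vocabulary) (V W : finType).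
Variables (A : structure tau V) (B : structure tau W).

Definition vars (C : {set fact tau V}) : {set V} := \bigcup_(f in C) scope f.

Definition hw_symbol : finType :=
  {C : {set fact tau V} | (C \subset facts A) && (0 < #|C| <= k)}.

(** The tuple of the view of C concatenates the scopes of the constraints in C;
    for C = {(R, t)} it is t itself, which gives the base view R_t. *)
Definition hw_seq (C : hw_symbol) : seq V :=
  flatten [seq tval (tagged f) | f : fact tau V <- enum (val C)].

Definition hw_voc : vocabulary :=
  @Vocabulary hw_symbol (fun C => size (hw_seq C)).

Definition hw_lfacts : {set fact hw_voc V} :=
  [set @mkfact hw_voc V C (in_tuple (hw_seq C)) | C : hw_symbol].

Lemma hw_lwf : [forall f in hw_lfacts, scope f \subset univ A].
Proof.
apply/forall_inP => _ /imsetP[C _ ->]; apply/subsetP => x; rewrite inE /=.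
case/flattenP => _ /mapP[f fC ->] xf.
have [/subsetP CA _] := andP (valP C); rewrite mem_enum in fC.
by move/subsetP: (scope_univ (CA _ fC)); apply; rewrite inE.
Qed.

Definition hw_l : structure hw_voc V := Structure hw_lwf.

Definition hw_rfacts : {set fact hw_voc W} :=
  [set g : fact hw_voc W |
    let C : hw_symbol := tag g in
    [exists h in solutions B (vars (val C)) (val C),
       maps h (hw_seq C) (tagged g)]].

Lemma maps_solutions_univ (X : {set V}) C h t (u : seq W) :
  h \in solutions B X C -> maps h t u -> {subset u <= univ B}.
Proof.
rewrite inE => /and3P[_ /forallP hB _] /eqP htu b bu.
have : Some b \in [seq Some b0 | b0 <- u] by rewrite map_f.
rewrite -htu => /mapP[x _ hx].
by have /forallP/(_ b)/implyP := hB x; apply; rewrite hx.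
Qed.

Lemma hw_rwf : [forall g in hw_rfacts, scope g \subset univ B].
Proof.
apply/forall_inP => g; rewrite inE => /exists_inP[h hS hm].
by apply/subsetP => b; rewrite inE => /(maps_solutions_univ hS hm).
Qed.

Definition hw_r : structure hw_voc W := Structure hw_rwf.

Definition tw_symbol : finType :=
  ({X : {set V} | (X \subset univ A) && (0 < #|X| <= k.+1)}
   + {f : fact tau V | f \in facts A})%type.

Definition tw_voc : vocabulary :=
  @Vocabulary tw_symbol (fun R =>
    match R with inl X => #|val X| | inr f => arity (tag (val f)) end).

Definition tw_tuple (R : tw_voc) : (arity R).-tuple V :=
  match R with
  | inl X => enum_tuple (val X)
  | inr f => tagged (val f)
  end.

Definition tw_lfacts : {set fact tw_voc V} :=
  [set mkfact (tw_tuple R) | R : tw_voc].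

Lemma tw_lwf : [forall f in tw_lfacts, scope f \subset univ A].
Proof.
apply/forall_inP => _ /imsetP[[X|f] _ ->].
  apply/subsetP => x; rewrite inE /= mem_enum.
  by have [/subsetP XA _] := andP (valP X); exact: XA.
exact: (scope_univ (valP f)).
Qed.

Definition tw_l : structure tw_voc V := Structure tw_lwf.

Definition tw_rfacts : {set fact tw_voc W} :=
  [set g : fact tw_voc W |
    match g with
    | existT (inl X) u =>
        [exists h in solutions B (val X)
                       [set f in facts A | scope f \subset val X],
           maps h (enum (val X)) u]
    | existT (inr f) u => @mkfact tau W (tag (val f)) u \in facts B
    end].

Lemma tw_rwf : [forall g in tw_rfacts, scope g \subset univ B].
Proof.
apply/forall_inP => -[[X|f] u]; rewrite inE; last by move/scope_univ.
move=> /exists_inP[h hS hm].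
by apply/subsetP => b; rewrite inE => /(maps_solutions_univ hS hm).
Qed.

Definition tw_r : structure tw_voc W := Structure tw_rwf.

End Methods.

Definition hw (k : nat) : method :=
  @Method (hw_voc k) (hw_l k) (fun tau V W A B => hw_r k A B).

Definition tw (k : nat) : method :=
  @Method (tw_voc k) (tw_l k) (fun tau V W A B => tw_r k A B).

Lemma hw_views (k : nat) (tau : vocabulary) (V : finType) (A : structure tau V) :
  is_view_structure (lDM (hw k) A).
Proof.
move=> R; exists (in_tuple (hw_seq R)); apply/setP => t; rewrite !inE.
apply/imsetP/eqP => [[C _ /eqP]|->]; last by exists R.
rewrite -tag_eqE /tag_eq /= => /andP[/eqP E].
by case: C / E => /eqP; rewrite tagged_asE => ->.
Qed.

Lemma tw_views (k : nat) (tau : vocabulary) (V : finType) (A : structure tau V) :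
  is_view_structure (lDM (tw k) A).
Proof.
move=> R; exists (tw_tuple R); apply/setP => t; rewrite !inE.
apply/imsetP/eqP => [[C _ /eqP]|->]; last by exists R.
rewrite -tag_eqE /tag_eq /= => /andP[/eqP E].
by case: C / E => /eqP; rewrite tagged_asE => ->.
Qed.

(* Main.v *)
Require Import Defs.
From mathcomp Require Import all_boot.
From mathcomp Require Import zify.

Set Implicit Arguments.
Unset Strict Implicit.
Unset Printing Implicit Defensive.

(** If O is tp-covered, assignments in the arc consistent view relations are
    glued along the join tree of the tree projection, starting from a hyperedge
    containing O; composing with a homomorphism from A to the core, which fixes O,
    gives a solution.

    Conversely, the views of A glued along common variables in all possible ways
    form an infinite tree-like structure on which arc consistency holds, and in
    which the image of a core inherits a tree decomposition into views.  A finite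
    quotient is obtained by labelling every element with its history: the view in
    which it was introduced, the elements inherited by that view, recursively up to
    a bounded depth, and a colour different from all those in its past.  A
    homomorphism from A labels a core of A + S_O in such a way that, colours
    excluding short cycles, there is a newest variable; its neighbourhood is then
    contained in the view where it was introduced.  Eliminating this variable and
    truncating all histories by one level, one builds a join tree by induction on
    the number of variables. *)

(** * Histories *)

Section Histories.
Variables (V : finType) (views : {set {set V}}) (M : nat).

(* A history consists of the view in which an element is introduced, the elements
   of that view that are older, and a colour.  The variables of the view without
   an elder are introduced together, and share their history. *)
Fixpoint history (n : nat) : finType :=
  if n is m.+1 then ({set V} * {ffun V -> option (history m)} * 'I_M)%type
  else unit.

Definition birth_view n (d : history n.+1) : {set V} := d.1.1.
Definition elders n (d : history n.+1) : {ffun V -> option (history n)} := d.1.2.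
Definition color n (d : history n.+1) : 'I_M := d.2.

Fixpoint truncate n : history n.+1 -> history n :=
  if n is m.+1 then
    fun d => (birth_view d, [ffun y => omap (@truncate m) (elders d y)], color d)
  else fun=> tt.

Fixpoint colors (k n : nat) : history n -> {set 'I_M} :=
  match k, n with
  | k'.+1, n'.+1 => fun d =>
      color d |: \bigcup_y (if elders d y is Some d' then colors k' d' else set0)
  | _, _ => fun=> set0
  end.

(** The labelling of the bag where [d] was introduced, one level shallower. The default serves the
    variables introduced together with [d], which share its history. *)
Definition birth_bag n (d : history n.+1) (y : V) : history n :=
  odflt (truncate d) (elders d y).

Definition elder_colors (k n : nat) (d : history n.+1) : {set 'I_M} :=
  \bigcup_y (if elders d y is Some d' then colors k d' else set0).

(** The past stored in a history is one level shallower than the history itself, so the entry for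
    [y] is compared with the truncated history of [y]. *)
Definition newer n (b : V -> history n.+1) (x y : V) : bool :=
  elders (b x) y == Some (truncate (b y)).

(* Two elements lie in a common bag: the younger one was introduced in a bag
   containing the older one, or they were introduced together. *)
Definition cohabit n (b : V -> history n.+1) (x y : V) : bool :=
  [|| newer b x y, newer b y x | b x == b y].

(** Approximates, to depth [n], the property that the bag [X] labelled by [b] occurs in the
    tree-like gluing of the views. The recursive call asks the same of the bag in which each element
    was introduced. *)
Fixpoint coherent n : {set V} -> (V -> history n) -> bool :=
  if n is m.+1 then fun X b =>
    [forall x in X,
      [&& (birth_view (b x) \in views) && (x \in birth_view (b x)),
          elders (b x) x == None,
          [forall y, (elders (b x) y != None) ==> (y \in birth_view (b x))],
          color (b x) \notin elder_colors m (b x),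
          coherent (birth_view (b x)) (birth_bag (b x))
        & [forall y in X, cohabit b x y]]]
  else fun _ _ => true.

Lemma coherentS n (X : {set V}) (b : V -> history n.+1) :
  reflect (forall x, x \in X ->
    [/\ (birth_view (b x) \in views) /\ (x \in birth_view (b x)),
        elders (b x) x = None,
        forall y, elders (b x) y != None -> y \in birth_view (b x),
        color (b x) \notin elder_colors n (b x)
      & coherent (birth_view (b x)) (birth_bag (b x)) /\
        forall y, y \in X -> cohabit b x y])
  (coherent X b).
Proof.
apply: (iffP forall_inP) => H x /H.
  case/and5P=> /andP[? ?] /eqP ? /forallP H3 ? /andP[? /forall_inP ?].
  by split=> // y; apply/implyP.
case=> -[H0 H1] H2 H3 H4 [H5 H6].
apply/and5P; split; rewrite ?H0 ?H1 ?H2 //.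
  by apply/forallP => y; apply/implyP/H3.
by apply/andP; split=> //; apply/forall_inP.
Qed.

Lemma coherent_eq n (X : {set V}) (b b' : V -> history n) :
  {in X, b =1 b'} -> coherent X b -> coherent X b'.
Proof.
case: n b b' => [//|n] b b' bb' /coherentS H; apply/coherentS => x xX.
have [H1 H2 H3 H4 [H5 H6]] := H x xX; rewrite -(bb' x xX); split=> //.
split=> // y yX; have := H6 y yX.
by rewrite /cohabit /newer -(bb' x xX) -(bb' y yX).
Qed.

Lemma coherentW n (X Y : {set V}) (b : V -> history n) :
  Y \subset X -> coherent X b -> coherent Y b.
Proof.
case: n b => [//|n] b /subsetP YX /coherentS H; apply/coherentS => x /YX xX.
by have [H1 H2 H3 H4 [H5 H6]] := H x xX; split=> //; split=> // y /YX; apply: H6.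
Qed.

Lemma colorsS k n (d : history n) : colors k d \subset colors k.+1 d.
Proof.
elim: k n d => [|k IHk] [|n] d; try exact: sub0set.
apply/setUS/subsetP => c /bigcupP[y _ cy]; apply/bigcupP; exists y => //.
by case: (elders d y) cy => // d'; apply: subsetP.
Qed.

Lemma colors_truncate k n (d : history n.+1) :
  k <= n -> colors k (truncate d) = colors k d.
Proof.
elim: k n d => [|k IHk] [|n] d //; rewrite ltnS => kn.
congr (_ |: _); apply: eq_bigr => y _.
by rewrite /elders ffunE -/(elders d); case: (elders d y) => //= d'; exact: IHk.
Qed.

Lemma elder_colors_truncate n (d : history n.+2) :
  elder_colors n (truncate d) \subset elder_colors n.+1 d.
Proof.
apply/subsetP => c /bigcupP[y _]; rewrite /elders ffunE -/(elders d) => cy.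
apply/bigcupP; exists y => //; case: (elders d y) cy => //= d'.
by rewrite colors_truncate //; apply/subsetP/colorsS.
Qed.

(** Truncation commutes with passing to the birth bag, so the induction on the depth applies to
    birth bags. *)
Lemma coherent_truncate n (X : {set V}) (b : V -> history n.+1) :
  coherent X b -> coherent X (fun x => truncate (b x)).
Proof.
elim: n X b => [//|n IHn] X b /coherentS H; apply/coherentS => x xX.
have [H1 H2 H3 H4 [H5 H6]] := H x xX; split=> //.
- by rewrite /elders ffunE -/(elders (b x)) H2.
- move=> y; rewrite /elders ffunE -/(elders (b x)).
  by case E: (elders (b x) y) => // _; apply: H3; rewrite E.
- by apply: contra H4; apply/subsetP/elder_colors_truncate.
split.
  apply: coherent_eq (IHn _ _ H5) => y _.
  by rewrite /birth_bag /= /elders ffunE -/(elders (b x)); case: (elders (b x) y).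
move=> y /H6; rewrite /cohabit /newer {1 3}/elders !ffunE -!/(elders _).
case/or3P=> [/eqP->|/eqP->|/eqP->]; rewrite /= ?eqxx ?orbT //.
Qed.

(** The common history of the variables that appear when the view [X] is glued along [Y] to a bag
    labelled by [b]. *)
Definition newborn n (X Y : {set V}) (b : V -> history n) (c : 'I_M) :
  history n :=
  match n return (V -> history n) -> history n with
  | 0 => fun=> tt
  | m.+1 => fun b =>
      (X, [ffun y => if y \in Y then Some (truncate (b y)) else None], c)
  end b.

Definition extend n (X Y : {set V}) (b : V -> history n) (c : 'I_M) (y : V) : history n :=
  if y \in Y then b y else newborn X Y b c.

Lemma truncate_newborn n (X Y : {set V}) (b : V -> history n.+1) c :
  truncate (newborn X Y b c) = newborn X Y (fun y => truncate (b y)) c.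
Proof.
case: n b => // n b; congr (_, _, _); apply/ffunP => y.
by rewrite /elders /= !ffunE; case: ifP.
Qed.

(** The birth bag of a new variable is the same extension built from truncated labels, hence an
    induction on the depth. The freshness of [c] gives the colour condition for the new
    variables. *)
Lemma coherent_extend n (X Y : {set V}) (b : V -> history n) c :
  Y \subset X -> X \in views -> coherent Y b ->
  (forall y, y \in Y -> c \notin colors n (b y)) ->
  coherent X (extend X Y b c).
Proof.
move=> /subsetP YX Xv; elim: n b => [//|n IHn] b cohb fresh.
have eldN y : elders (newborn X Y b c) y =
    if y \in Y then Some (truncate (b y)) else None by rewrite /elders ffunE.
have fresh' y : y \in Y -> c \notin colors n (truncate (b y)).
  move=> /fresh; rewrite colors_truncate //.
  by apply: contra; apply/subsetP/colorsS.
have IH := IHn _ (coherent_truncate cohb) fresh'.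
move/coherentS: cohb => H; apply/coherentS => x xX.
have [xY|xY] := boolP (x \in Y).
  have -> : extend X Y b c x = b x by rewrite /extend xY.
  have [H1 H2 H3 H4 [H5 H6]] := H x xY; split=> //; split=> // y yX.
  rewrite /cohabit /newer /extend xY; have [/H6 //|yY] := boolP (y \in Y).
  by rewrite eldN xY eqxx orbT.
have -> : extend X Y b c x = newborn X Y b c by rewrite /extend (negPf xY).
split=> //.
- by rewrite eldN (negPf xY).
- by move=> y; rewrite eldN; case: ifP => // /YX.
- apply/bigcupP => -[y _]; rewrite eldN; case: ifP => [yY|]; last by rewrite inE.
  exact/negP/fresh'.
split.
  apply: coherent_eq IH => y _.
  by rewrite /birth_bag /extend eldN truncate_newborn; case: ifP.
move=> y yX; rewrite /cohabit /newer /extend (negPf xY) eldN.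
by case: ifP => _; rewrite eqxx ?orbT.
Qed.

(** Bounds the number of colours visible to depth [n]: each level branches over at most [#|V|]
    elders. One more level of the recursion counts the colours of a whole bag and leaves one to
    spare. *)
Fixpoint palette_size n := if n is m.+1 then (#|V| * palette_size m).+1 else 0.

Lemma card_bigcup_le (F : V -> {set 'I_M}) m :
  (forall y, #|F y| <= m) -> #|\bigcup_y F y| <= #|V| * m.
Proof.
move=> Fm; apply: (@leq_trans (\sum_(y : V) #|F y|)).
  elim/big_rec2: _ => [|y k B _ le]; first by rewrite cards0.
  by apply: leq_trans (leq_card_setU _ _) _; rewrite leq_add2l.
by apply: leq_trans (leq_sum _ (fun y _ => Fm y)) _; rewrite sum_nat_const.
Qed.

Lemma card_colors k n (d : history n) : #|colors k d| <= palette_size k.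
Proof.
elim: k n d => [|k IHk] [|n] d; rewrite ?cards0 //=.
apply: leq_trans (leq_card_setU _ _) _; rewrite cards1 add1n ltnS.
by apply: card_bigcup_le => y; case: (elders d y) => [d'|]; rewrite ?cards0.
Qed.

Lemma fresh_color n (b : V -> history n) :
  palette_size n.+1 <= M -> exists c, forall y, c \notin colors n (b y).
Proof.
move=> leM; have: #|\bigcup_y colors n (b y)| < #|'I_M|.
  rewrite card_ord; apply: leq_trans leM; rewrite ltnS.
  by apply: card_bigcup_le => y; exact: card_colors.
rewrite ltnNge => /negP ltC; case: (pickP (mem (~: \bigcup_y colors n (b y)))) => [c|none].
  by rewrite !inE => cN; exists c => y; apply: contra cN => ?; apply/bigcupP; exists y.
case: ltC; rewrite -cardsT; apply/subset_leq_card/subsetP => c _.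
by have := none c; rewrite !inE => /negbFE.
Qed.

(** Each step into the past costs one level, and the bound on [k + size s] ensures that truncation
    has not erased the colours followed. *)
Lemma newer_path n (b : V -> history n.+1) k x s :
  path (newer b) x s -> k + size s <= n.+1 ->
  colors k (b (last x s)) \subset colors (k + size s) (b x).
Proof.
elim: s x => [|y s IHs] x; first by rewrite addn0.
rewrite /= addnS => /andP[/eqP xy ys] kn; rewrite ltnS in kn.
apply: subset_trans (IHs y ys (leqW kn)) _.
rewrite -(colors_truncate _ kn) /=; apply: subset_trans (subsetUr _ _).
by apply: (bigcup_max y); rewrite ?xy.
Qed.

(* Along a cycle, [x] reappears in its own past, at a depth that truncation has
   not yet removed; this contradicts the freshness of its colour. *)
Lemma newer_acyclic n (b : V -> history n.+1) x s :
  size s < n -> path (newer b) x (rcons s x) ->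
  color (b x) \in elder_colors n (b x).
Proof.
move=> sn; case: s sn => [|y s] /= sn.
  rewrite andbT => /eqP xx; apply/bigcupP; exists x => //; rewrite xx.
  by rewrite colors_truncate //; case: (n) sn b xx => // m _ b xx; rewrite !inE eqxx.
case/andP => /eqP xy ys.
have sub := @newer_path _ b 1 y (rcons s x) ys.
rewrite last_rcons size_rcons in sub.
apply/bigcupP; exists y => //; rewrite xy colors_truncate //.
have: color (b x) \in colors 1 (b x) by rewrite !inE eqxx.
move/(subsetP (sub _)) => cx; have {cx} := cx ltac:(lia).
have mono k k' d : k <= k' -> @colors k n.+1 d \subset colors k' d.
  move/subnK <-; elim: (k' - k) => // j IHj; exact: subset_trans IHj (colorsS _ _).
by apply/subsetP/mono; lia.
Qed.

End Histories.

(** * Join trees *)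

Section JoinTrees.
Variable V : finType.

Lemma subsets_of_setT (E : {set {set V}}) : [forall h in E, h \subset [set: V]].
Proof. by apply/forall_inP => h _; exact: subsetT. Qed.

Definition span (E : {set {set V}}) : hypergraph V :=
  Hypergraph (subsets_of_setT E).

Definition graft (e : rel {set V}) (N m : {set V}) : rel {set V} :=
  fun a b => [|| e a b, (a == N) && (b == m) | (a == m) && (b == N)].

(** As [x] occurs in no hyperedge of [E], the set [N] is a new vertex, attached as a leaf to [m].
    Whatever [N] shares with a hyperedge of [E] avoids [x], hence lies in [m], and running
    intersection is preserved. *)
Lemma join_tree_graft (E : {set {set V}}) (e : rel {set V}) (N m : {set V}) x :
  is_join_tree (span E) e -> m \in E -> x \in N -> N :\ x \subset m ->
  (forall h, h \in E -> x \notin h) ->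
  is_join_tree (span (N |: E)) (graft e N m).
Proof.
move=> [[/= sym irr inE_ conn cyc] run] mE xN /subsetP Nm xE.
have NE : N \notin E by apply: contraL xN => /xE.
have mN : (m == N) = false by apply/eqP => mN; rewrite -mN mE in NE.
have Nx y h : h \in E -> y \in h -> y \in N -> y \in m.
  move=> hE yh yN; apply: Nm; rewrite !inE yN andbT.
  by apply: contraTneq yh => ->; exact: xE.
set g := graft e N m.
have gsym : symmetric g.
  by move=> a b; rewrite /g /graft sym; congr (_ || _); rewrite orbC; congr (_ || _); exact: andbC.
have eN b : e N b = false.
  by apply/negP => /inE_ /andP[]; rewrite (negPf NE).
have gN b : g N b = (b == m).
  by rewrite /g /graft eN eqxx /= [N == m]eq_sym mN orbF.
have gE a b : a != N -> b != N -> g a b = e a b.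
  by move=> /negPf aN /negPf bN; rewrite /g /graft aN bN andbF !orbF.
have pathE a p : N \notin a :: p -> path g a p -> path e a p.
  elim: p a => //= b p IHp a; rewrite !in_cons !negb_or => /and3P[Na Nb Np].
  rewrite gE 1?eq_sym // => /andP[-> gp]; apply: IHp => //.
  by rewrite in_cons negb_or Nb.
have subg : subrel e g by move=> a b; rewrite /g /graft => ->.
have connE : {in E &, forall a b, connect g a b}.
  by move=> a b aE bE; apply: (connect_sub (e := e)) (conn _ _ aE bE) => ? ? /subg/connect1.
have connN a : a \in E -> connect g N a.
  by move=> aE; apply: connect_trans (connE _ _ mE aE); apply: connect1; rewrite gN.
split; first split=> //=.
- move=> a; rewrite /g /graft irr /= andbC orbb.
  by apply/negbTE/negP => /andP[/eqP-> ]; rewrite mN.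
- move=> a b /or3P[/inE_/andP[aE bE]|/andP[/eqP-> /eqP->]|/andP[/eqP-> /eqP->]];
  by rewrite !inE ?aE ?bE ?mE ?eqxx ?orbT.
- move=> a b; rewrite !inE => /predU1P[->|aE] /predU1P[->|bE] //.
  + exact: connN.
  + by rewrite (sym_connect_sym gsym); exact: connN.
  + exact: connE.
- move=> c c3; apply/negP => /andP[gc uc].
  (* On a cycle through [N], both neighbours of [N] would be [m], contradicting uniqueness. *)
  have [Nc|Nc] := boolP (N \in c).
    case/rot_to: Nc => i c' ci; move: gc uc c3.
    rewrite -(rot_cycle i) -(rot_uniq i) -(size_rot i) ci.
    case: c' {ci} => // y c'; case/lastP: c' => // c' z /=.
    rewrite gN rcons_path last_rcons gsym gN => /and3P[/eqP-> _ /eqP->].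
    by rewrite mem_rcons in_cons eqxx andbF.
  have /negP[] := cyc c c3; rewrite uc andbT; case: c Nc gc {c3 uc} => //= a c Nc.
  apply: pathE; rewrite -rcons_cons mem_rcons !in_cons.
  by move: Nc; rewrite in_cons; case: (N == a).
(* A simple path can meet the leaf [N] only at an end. Without [N] it is a path of the old tree with
   an end at [m], and [m] contains [y]. *)
move=> y h p; rewrite /= inE => hNE yh gp up ylast h' h'p.
have [Np|Np] := boolP (N \in p); last first.
  move: hNE; rewrite inE => /predU1P[hN|hE]; last first.
    apply: (run y h p) => //; apply: pathE => //.
    by rewrite in_cons negb_or Np andbT; apply: contraNneq NE => ->.
  case: p gp up ylast h'p Np => //= a p; rewrite hN gN => /andP[/eqP-> gp].
  move=> /andP[_ up] ylast h'p Np.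
  have ep : path e m p by exact: pathE.
  have lE : last m p \in E.
    case/lastP: p ep {gp up ylast h'p Np} => // p z.
    by rewrite rcons_path last_rcons => /andP[_ /inE_/andP[]].
  have ym : y \in m by apply: Nx ylast _; rewrite -?hN.
  by move: h'p; rewrite in_cons => /predU1P[-> //|]; apply: (run y m p).
case/splitPr: Np gp up ylast h'p => p1 p2.
rewrite -[_ && _]/(uniq (h :: _)) -cat_cons cat_uniq last_cat cat_path /= gsym gN.
move=> /and3P[gp1 /eqP lm gp2].
case: p2 gp2 => [_|b p2 /=]; last first.
  rewrite gN => /andP[/eqP-> _] /and4P[_ /norP[_ /norP[]]].
  by rewrite -lm mem_last.
rewrite orbF andbT => /andP[/andP[hp1 up1] Np1] yN.
have hE : h \in E.
  move: hNE; rewrite inE => /predU1P[hN|//].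
  by rewrite hN in_cons eqxx in Np1.
rewrite mem_cat mem_seq1 => /orP[h'p1|/eqP-> //].
apply: (run y h p1) => //; first exact: pathE.
- by rewrite /= hp1.
- by rewrite lm; apply: Nx yh yN.
Qed.

Lemma connect_exit (T : finType) (e : rel T) (S : {set T}) x y :
  connect e x y -> x \in S -> y \notin S ->
  exists a b, [/\ a \in S, b \notin S & e a b].
Proof.
case/connectP=> p; elim: p x => [|z p IHp] x /= => [_ -> -> //|].
move=> /andP[xz zp] yl xS yS; have [zS|zS] := boolP (z \in S).
  exact: IHp zp yl zS yS.
by exists x, z.
Qed.

(* Assignments are glued along the tree, hyperedge by hyperedge: the part of a
   new hyperedge already assigned lies, by the running intersection property,
   in the neighbour through which it is reached. *)
Lemma join_tree_glue (T : Type) (H : hypergraph V) (e : rel {set V})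
    (Q : {set V} -> (V -> T) -> Prop) (h0 : {set V}) g0 :
  is_join_tree H e ->
  (forall (h : {set V}) g g', {in h, g =1 g'} -> Q h g -> Q h g') ->
  (forall (h h' : {set V}) g, h \in hedges H -> h' \in hedges H -> Q h g ->
     exists2 g', Q h' g' & {in h :&: h', g =1 g'}) ->
  h0 \in hedges H -> Q h0 g0 ->
  exists2 g, (forall h, h \in hedges H -> Q h g) & {in h0, g =1 g0}.
Proof.
move=> [[sym _ inE_ conn _] run] Qext Qstep h0H Qh0; set E := hedges H.
pose inner (S : {set {set V}}) : rel {set V} :=
  fun a b => [&& e a b, a \in S & b \in S].
(* [S] is a connected part of the tree on which [g] is already correct; the induction is on the
   number of hyperedges outside [S]. *)
suff grow m (S : {set {set V}}) g : #|E :\: S| <= m -> S \subset E -> h0 \in S ->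
    {in S &, forall a b, connect (inner S) a b} ->
    (forall h, h \in S -> Q h g) ->
    exists2 g', (forall h, h \in E -> Q h g') & {in h0, g' =1 g}.
  apply: (grow _ [set h0] g0 (leqnn _)); rewrite ?sub1set ?inE //.
  - by move=> a b; rewrite !inE => /eqP-> /eqP->; exact: connect0.
  - by move=> h; rewrite inE => /eqP->.
elim: m S g => [|m IHm] S g Sm SE h0S cS QS.
  exists g => // h hE; apply: QS; apply: contraLR Sm => hS.
  by rewrite -ltnNge card_gt0; apply/set0Pn; exists h; rewrite inE hS.
have [/eqP ES0|/set0Pn[h1]] := boolP (E :\: S == set0).
  by exists g => // h hE; apply: QS; apply/negPn/negP => hS;
    have := in_set0 h; rewrite -ES0 inE hS hE.
rewrite inE => /andP[h1S h1E].
have [a [b [aS bS ab]]] := connect_exit (conn _ _ h0H h1E) h0S h1S.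
have /andP[aE bE] := inE_ _ _ ab.
(* A simple path from [c] to [a] inside [S] extends by [b], which lies outside [S]; running
   intersection then forces [x] into [a]. *)
have meet c x : c \in S -> x \in b -> x \in c -> x \in a.
  move=> cS' xb xc; have /connectP[p0 ip al] := cS _ _ cS' aS.
  case/shortenP: ip al => p ip up _ al.
  have ep : path e c p by apply: sub_path ip => ? ? /and3P[].
  have sp : {subset c :: p <= S}.
    move=> z; rewrite in_cons => /predU1P[-> //|].
    elim: (p) (c) ip => //= d q IHq c' /andP[/and3P[_ _ dS] iq].
    by rewrite in_cons => /predU1P[-> //|]; exact: IHq iq.
  have [ac|ap] : a = c \/ a \in p.
    by have := mem_last c p; rewrite -al in_cons => /predU1P; case; [left|right].
    by rewrite ac.
  apply: (run x c (rcons p b)) => //.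
  - exact: (subsetP SE).
  - by rewrite rcons_path ep -al.
  - by rewrite -rcons_cons rcons_uniq up andbT; apply: contra bS => /sp.
  - by rewrite last_rcons.
  - by rewrite mem_rcons in_cons ap orbT.
have [gb Qgb gbE] := Qstep a b g aE bE (QS a aS).
pose g' x := if x \in b then gb x else g x.
have g'S c : c \in S -> {in c, g' =1 g}.
  move=> cS' x xc; rewrite /g'; case: ifP => // xb.
  by rewrite gbE // inE (meet c x).
have [|||||g2 Q2 g2E] := IHm (b |: S) g'.
- rewrite -ltnS; apply: leq_trans Sm; apply: proper_card; rewrite properE.
  apply/andP; split; first by apply/setDS; exact: subsetUr.
  by apply/subsetPn; exists b; rewrite !inE ?eqxx // bS.
- by rewrite subUset sub1set bE.
- by rewrite inE h0S orbT.
- have subS : subrel (inner S) (inner (b |: S)).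
    by move=> c d /and3P[cd cS' dS]; rewrite /inner cd !inE cS' dS !orbT.
  have symS : connect_sym (inner (b |: S)).
    by apply: sym_connect_sym => c d; rewrite /inner sym [(c \in _) && _]andbC.
  have cS' : {in S &, forall c d, connect (inner (b |: S)) c d}.
    move=> c d cS' dS; apply: (connect_sub (e := inner S)) (cS _ _ cS' dS).
    by move=> ? ? /subS/connect1.
  have cb c : c \in S -> connect (inner (b |: S)) c b.
    move=> cSin; apply: connect_trans (cS' _ _ cSin aS) (connect1 _).
    by rewrite /inner ab !inE eqxx aS orbT.
  move=> c d; rewrite !inE => /predU1P[->|cSin] /predU1P[->|dSin] //.
  + by rewrite symS cb.
  + exact: cb.
  + exact: cS'.
- move=> c; rewrite inE in_set1 => /orP[/eqP->|cSin].
    by apply: Qext Qgb => x xb; rewrite /g' xb.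
  by apply: Qext (QS c cSin) => x xc; rewrite (g'S c).
by exists g2 => // x xh; rewrite g2E // (g'S h0).
Qed.

End JoinTrees.

(** * Elimination of the newest variable *)

Section Elimination.
Variables (V : finType) (views : {set {set V}}) (M : nat).
Local Notation history := (history V M).

(** Take [x] reaching the most elements of [Y] through [newer]. An element newer than [x] would
    reach strictly more, unless it closed a cycle, which the colours exclude. *)
Lemma newest_exists n (Y : {set V}) (b : V -> history n.+1) :
  {in Y, forall x, color (b x) \notin elder_colors n (b x)} ->
  Y != set0 -> #|Y| <= n ->
  exists2 x, x \in Y & {in Y, forall y, ~~ newer b y x}.
Proof.
move=> fresh /set0Pn[x0 x0Y] Yn.
pose r := [rel x y | [&& newer b x y, x \in Y & y \in Y]].
have [x xY xmax] := arg_maxnP (fun x => #|connect r x|) x0Y.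
exists x => // y yY; apply/negP => yx.
have ryx : r y x by apply/and3P; split.
have sub : connect r x \subset connect r y.
  by apply/subsetP => z; apply: connect_trans; exact: connect1.
have Ny : y \notin connect r x.
  apply/negP => /connectP[p0 rp0 yl0].
  case/shortenP: rp0 yl0 => p rp up _ yl.
  have /negP[] := fresh _ yY.
  (* The simple path from [x] to [y] closes to a cycle through [y]. It stays in [Y], so its length
     is within the depth [n]. *)
  apply: (@newer_acyclic _ _ _ _ y (belast x p)).
    rewrite size_belast; apply: leq_trans Yn.
    suff /subset_leq_card : x :: p \subset Y by rewrite (card_uniqP up).
    apply/subsetP => z; rewrite in_cons => /predU1P[-> //|].
    elim: (p) (x) rp => //= a q IHq c /andP[/and3P[_ _ aY] rq].
    by rewrite in_cons => /predU1P[-> //|]; exact: IHq rq.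
  rewrite {2}yl -lastI /= yx /=; apply: sub_path rp.
  by move=> a c /and3P[].
have: #|connect r x| < #|connect r y|.
  apply: proper_card; rewrite properE sub; apply/subsetPn.
  by exists y => //; exact: connect0.
by rewrite ltnNge; have /= -> := xmax _ yY.
Qed.

(** Since nothing in [e] is newer than [x], every element of [e] is an elder of [x] or shares its
    history. Either way it lies in the birth view, where its recorded label is its truncated one. *)
Lemma newest_neighbourhood n (b : V -> history n.+1) (e : {set V}) x :
  coherent views e b -> x \in e -> {in e, forall y, ~~ newer b y x} ->
  e \subset birth_view (b x) /\
  {in e, forall y, birth_bag (b x) y = truncate (b y)}.
Proof.
move=> /coherentS H xe new.
have [H1 H2 H3 H4 [H5 H6]] := H x xe.
have mem y : y \in e -> newer b x y \/ b x = b y.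
  move=> ye; have := H6 y ye; rewrite /cohabit (negPf (new y ye)) /=.
  by case/orP => [->|/eqP->]; [left | right].
split.
  apply/subsetP => y ye; case: (mem y ye) => [/eqP E|->]; first by apply: H3; rewrite E.
  by have [[]] := H y ye.
move=> y ye; case: (mem y ye) => [/eqP E|E]; first by rewrite /birth_bag E.
by rewrite /birth_bag E; have [_ -> _ _] := H y ye.
Qed.

Lemma join_tree_small (H : {set {set V}}) :
  cover H = set0 -> is_join_tree (span H) (fun _ _ => false).
Proof.
move=> H0; have HE h : h \in H -> h = set0.
  by move=> hH; apply/eqP; rewrite -subset0 -H0; exact: (bigcup_sup h).
split; first split=> //=.
- by move=> x y /HE-> /HE->; exact: connect0.
- by case=> [|a [|c s]].
by move=> x h p /= /HE->; rewrite inE.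
Qed.

(** Induction on the depth, one variable and one level at a time: the hyperedges through the newest
    variable [x] fit together into one view. Their union [N] becomes a leaf of the join tree
    obtained for the remaining variables. *)
Lemma coherent_tree_projection n (H : {set {set V}}) (b : V -> history n) :
  (forall e, e \in H -> coherent views e b /\ exists2 X, X \in views & e \subset X) ->
  #|cover H| < n ->
  exists E : {set {set V}}, [/\ exists r, is_join_tree (span E) r,
    forall e, e \in H -> exists2 h, h \in E & e \subset h
  & forall h, h \in E -> h \subset cover H /\ exists2 X, X \in views & h \subset X].
Proof.
elim: n H b => [//|n IHn] H b coh; rewrite ltnS => Hn.
have [H0|H0] := eqVneq (cover H) set0.
  exists H; split.
  - by exists (fun _ _ => false); exact: join_tree_small.
  - by move=> e eH; exists e.
  - by move=> h hH; split; [exact: (bigcup_sup h) | have [] := coh h hH].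
have [|x xY new] := @newest_exists n (cover H) b _ H0 Hn.
  move=> x /bigcupP[e eH xe]; have [/coherentS/(_ x xe)[]] := coh e eH.
  by [].
pose S := [set e in H | x \in e]; pose N := cover S.
have eN e : e \in H -> x \in e -> e \subset N.
  by move=> eH xe; apply: (bigcup_sup e); rewrite inE eH.
have nbh e : e \in S -> e \subset birth_view (b x) /\
    {in e, forall y, birth_bag (b x) y = truncate (b y)}.
  rewrite inE => /andP[eH xe]; have [ce _] := coh e eH.
  apply: newest_neighbourhood ce xe _ => y ye; apply: new.
  by apply/bigcupP; exists e.
have [e0 e0H xe0] := bigcupP xY.
have [ce0 _] := coh e0 e0H.
have /coherentS/(_ x xe0)[[wv _] _ _ _ [cw _]] := ce0.
have Nw : N \subset birth_view (b x) by apply/bigcupsP => e /nbh[].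
(* On [N] the truncated labels coincide with the birth bag of [x], which is coherent by recursion; a
   level is spent here. *)
have cN : coherent views N (fun y => truncate (b y)).
  apply: (@coherent_eq _ _ _ _ _ (birth_bag (b x))); last exact: coherentW Nw cw.
  by move=> y /bigcupP[e /nbh[_ E] /E].
have xN : x \in N by apply: (subsetP (eN _ e0H xe0)).
have NH : N \subset cover H.
  by apply/bigcupsP => e; rewrite inE => /andP[eH _]; exact: (bigcup_sup e).
(* Keeping [N :\ x] as a hyperedge guarantees a vertex [m] to which [N] can be attached. *)
pose H' := (N :\ x) |: [set e in H | x \notin e].
have sub : cover H' \subset cover H :\ x.
  apply/bigcupsP => e; rewrite !inE => /orP[/eqP->|/andP[eH xe]].
    exact: setSD.
  by rewrite subsetD1 xe andbT; exact: (bigcup_sup e).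
have [||E [[r jt] cov sm]] := IHn H' (fun y => truncate (b y)).
- move=> e; rewrite !inE => /orP[/eqP->|/andP[eH xe]].
    split; first exact: coherentW (subsetDl _ _) cN.
    by exists (birth_view (b x)) => //; apply: subset_trans Nw; exact: subsetDl.
  have [ce ev] := coh e eH; split=> //; exact: coherent_truncate.
- apply: leq_ltn_trans (subset_leq_card sub) _; apply: leq_trans Hn.
  by rewrite [in X in _ < X](cardsD1 x) xY.
have [m mE Nm] : exists2 m, m \in E & N :\ x \subset m by apply: cov; rewrite setU11.
exists (N |: E); split.
- exists (graft r N m); apply: join_tree_graft jt mE xN Nm _ => h /sm[hH _].
  by apply/negP => /(subsetP hH)/(subsetP sub); rewrite !inE eqxx.
- move=> e eH; have [xe|xe] := boolP (x \in e).
    by exists N; [rewrite setU11 | exact: eN].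
  have [|h hE eh] := cov e; first by rewrite !inE eH xe orbT.
  by exists h => //; rewrite inE hE orbT.
move=> h; rewrite inE in_set1 => /orP[/eqP->|/sm[hH hv]].
  by split=> //; exists (birth_view (b x)).
split=> //; apply: subset_trans hH (subset_trans sub _); exact: subsetDl.
Qed.

End Elimination.

(** * Views and generalized arc consistency *)

Section Assignments.
Variables (V W : finType).
Implicit Types (h : assignment V W) (t : seq V) (u : seq W).

Lemma eq_maps h h' t u : {in t, h =1 h'} -> maps h t u = maps h' t u.
Proof. by move=> /eq_in_map E; rewrite /maps E. Qed.

Lemma maps_agree h h' t u : maps h t u -> maps h' t u -> {in t, h =1 h'}.
Proof. by move=> /eqP hu /eqP h'u; apply/eq_in_map; rewrite hu. Qed.

Lemma maps_Some h t u x : maps h t u -> x \in t -> exists2 b, h x = Some b & b \in u.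
Proof.
move=> /eqP hu xt; have /mapP[b bu hx] : h x \in [seq Some b | b <- u].
  by rewrite -hu map_f.
by exists b.
Qed.

Lemma maps_tuple h n (t : n.-tuple V) :
  {subset t <= dom h} -> exists u : n.-tuple W, maps h t u.
Proof.
move=> td; have E : [seq Some b | b <- pmap h t] = [seq h x | x <- t].
  have {td} : {subset tval t <= dom h} by [].
  elim: (tval t) => //= x s IHs sd.
  have : x \in dom h by apply: sd; exact: mem_head.
  rewrite inE; case: (h x) => //= b _; rewrite IHs // => y ys.
  by apply: sd; rewrite in_cons ys orbT.
have sz : size (pmap h t) == n by have := congr1 size E; rewrite !size_map size_tuple => ->.
by exists (Tuple sz); rewrite /maps E.
Qed.

Lemma restrictE (X : {set V}) h x : x \in X -> restrict X h x = h x.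
Proof. by rewrite ffunE => ->. Qed.

Lemma dom_restrict (X : {set V}) h : X \subset dom h -> dom (restrict X h) = X.
Proof.
move=> /subsetP Xd; apply/setP => x; rewrite inE ffunE.
by case: ifP => // /Xd; rewrite inE.
Qed.

Lemma restrict_dom h : restrict (dom h) h = h.
Proof. by apply/ffunP => x; rewrite ffunE inE; case: (h x). Qed.

Lemma eq_restrict (X : {set V}) h h' : {in X, h =1 h'} -> restrict X h = restrict X h'.
Proof. by move=> E; apply/ffunP => x; rewrite !ffunE; case: ifP => // /E. Qed.

Lemma restrict_agree (X : {set V}) h h' : restrict X h = restrict X h' -> {in X, h =1 h'}.
Proof. by move=> E x xX; rewrite -(restrictE h xX) E restrictE. Qed.

Lemma eq_assignment h h' : dom h = dom h' -> {in dom h, h =1 h'} -> h = h'.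
Proof. by move=> dd /eq_restrict E; rewrite -(restrict_dom h) E dd restrict_dom. Qed.

Lemma eq_satisfies (tau : vocabulary) (B : structure tau W) h h' (f : fact tau V) :
  {in scope f, h =1 h'} -> satisfies B h f = satisfies B h' f.
Proof.
move=> E; apply: eq_existsb => u; congr (_ && _); apply: eq_maps => x xt.
by apply: E; rewrite inE.
Qed.

Lemma solutionsP (tau : vocabulary) (B : structure tau W) (X : {set V})
    (C : {set fact tau V}) h :
  reflect [/\ dom h = X, forall x b, h x = Some b -> b \in univ B
            & forall f, f \in C -> satisfies B h f]
          (h \in solutions B X C).
Proof.
rewrite inE; apply: (iffP and3P) => [[/eqP-> /forallP H1 /forall_inP H2]|[-> H1 H2]].
  by split=> // x b /eqP hx; have /forallP/(_ b)/implyP := H1 x; apply.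
split=> //; last exact/forall_inP.
by apply/forallP => x; apply/forallP => b; apply/implyP => /eqP; exact: H1.
Qed.

End Assignments.

Section Views.
Variables (tauV : vocabulary) (V : finType) (AV : structure tauV V).
Hypothesis AV_views : is_view_structure AV.
Local Notation vv := (view_vars AV).

Lemma view_varsE R t : interp AV R = [set t] -> vv R = [set x in t].
Proof. by rewrite /view_vars => ->; rewrite big_set1. Qed.

Lemma hyp_viewsP (X : {set V}) : reflect (exists R, X = vv R) (X \in hedges (hyp AV)).
Proof.
apply: (iffP imsetP) => [[[R t] fA ->]|[R ->]].
  exists R; have [t' tE] := AV_views R; rewrite (view_varsE tE) /scope /=.
  have : t \in interp AV R by rewrite inE.
  by rewrite tE => /set1P->.
have [t tE] := AV_views R; exists (mkfact t); last by rewrite (view_varsE tE).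
by have := set11 t; rewrite -tE inE.
Qed.

Lemma view_vars_univ R : vv R \subset univ AV.
Proof.
have /imsetP[f fA ->] : vv R \in hedges (hyp AV) by apply/hyp_viewsP; exists R.
exact: scope_univ.
Qed.

Lemma view_relP (W : finType) (BV : structure tauV W) R t (h : assignment V W) :
  interp AV R = [set t] ->
  reflect [/\ dom h = vv R & exists2 u : (arity R).-tuple W, mkfact u \in facts BV & maps h t u]
    (h \in view_rel AV BV R).
Proof.
move=> tE; rewrite (view_relE _ _ tE).
apply: (iffP andP) => -[dh].
  by case/exists_inP => u; rewrite inE => *; split; [exact/eqP | exists u].
by case=> u uB hu; rewrite dh eqxx; split=> //; apply/exists_inP; exists u; rewrite ?inE.
Qed.

Section Relations.
Variables (W : finType) (BV : structure tauV W).

Lemma view_rel_dom R h : h \in view_rel AV BV R -> dom h = vv R.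
Proof. by have [t tE] := AV_views R; case/(view_relP _ _ tE). Qed.

Lemma view_rel_univ R h x b :
  h \in view_rel AV BV R -> h x = Some b -> b \in univ BV.
Proof.
have [t tE] := AV_views R; case/(view_relP _ _ tE) => dh [u uB hu] hx.
have xt : x \in t.
  have : x \in dom h by rewrite inE hx.
  by rewrite dh (view_varsE tE) inE.
have [b' hx' bu] := maps_Some hu xt; move: bu; rewrite hx in hx'; case: hx' => <- bu.
by apply: (subsetP (scope_univ uB)); rewrite inE.
Qed.

Lemma GAC_sub R : view_rel AV (GAC AV BV) R \subset view_rel AV BV R.
Proof. by apply: view_relS; exact: subsetIl. Qed.

(** Maximality of GAC, for families of assignments rather than sets of tuples. Inclusions between
    projections suffice, as the two views can be exchanged. *)
Lemma sub_GAC (S : tauV -> {set assignment V W}) :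
  (forall R, S R \subset view_rel AV BV R) ->
  (forall R R', vv R :&: vv R' != set0 ->
     proj (vv R :&: vv R') (S R) \subset proj (vv R :&: vv R') (S R')) ->
  forall R, S R \subset view_rel AV (GAC AV BV) R.
Proof.
move=> SB Sac.
(* The tuples that realise the assignments of [S]; pruning by [F] leaves exactly the family [S]. *)
pose F := [set g : fact tauV W | [exists h in S (tag g),
  [forall t in interp AV (tag g), maps h t (tagged g)]]].
have FE R : view_rel AV (prune BV F) R = S R.
  have [t tE] := AV_views R; apply/setP => h; apply/(view_relP _ _ tE)/idP.
    case=> dh [u]; rewrite !inE => /andP[_ /exists_inP[h' h'S /forall_inP h't]] ht.
    have {}h't : maps h' t u by apply: h't; rewrite tE inE.
    suff -> : h = h' by [].
    have dh' := view_rel_dom (subsetP (SB R) _ h'S).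
    apply: eq_assignment; first by rewrite dh dh'.
    move=> x; rewrite dh (view_varsE tE) inE; exact: maps_agree ht h't x.
  move=> hS; have : h \in view_rel AV BV R by exact: (subsetP (SB R)).
  case/(view_relP _ _ tE) => dh [u uB hu].
  split=> //; exists u => //; rewrite !inE uB; apply/exists_inP; exists h => //.
  by apply/forall_inP => t'; rewrite tE inE => /eqP->.
move=> R; rewrite -FE; apply: view_relS; apply: setIS; apply: bigcup_sup.
apply/forallP => R1; apply/forallP => R2; apply/implyP => X0.
by rewrite !FE eqEsubset Sac //= setIC Sac // setIC.
Qed.

Lemma GAC_agree R R' h : h \in view_rel AV (GAC AV BV) R ->
  vv R :&: vv R' != set0 ->
  exists2 h', h' \in view_rel AV (GAC AV BV) R' & {in vv R :&: vv R', h =1 h'}.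
Proof.
move=> hR X0; have /forallP/(_ R)/forallP/(_ R')/implyP/(_ X0)/eqP E := GAC_consistent BV AV_views.
have : restrict (vv R :&: vv R') h \in proj (vv R :&: vv R') (view_rel AV (GAC AV BV) R).
  exact: imset_f.
by rewrite E => /imsetP[h' h'R /restrict_agree]; exists h'.
Qed.

End Relations.
End Views.

(** * Common properties of the two methods *)

(** The interface through which [tw k] and [hw k] enter the proof. Views are bounded on two sides:
    base views enforce their constraint, and no view excludes an assignment satisfying all
    constraints within its variables. *)
Record adequate (DM : method) (tau : vocabulary) (V : finType)
  (A : structure tau V) : Prop := Adequate {
  ad_views : is_view_structure (lDM DM A);
  ad_neq0 : forall R, view_vars (lDM DM A) R != set0;
  ad_lunivE : univ (lDM DM A) = univ A;
  ad_runivE : forall (W : finType) (B : structure tau W), univ (rDM DM A B) = univ B;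
  ad_base : forall f, f \in facts A -> exists2 R,
    view_vars (lDM DM A) R = scope f &
    forall (W : finType) (B : structure tau W) h,
      h \in view_rel (lDM DM A) (rDM DM A B) R -> satisfies B h f;
  ad_solutions : forall (W : finType) (B : structure tau W) R,
    let X := view_vars (lDM DM A) R in
    solutions B X [set f in facts A | scope f \subset X]
      \subset view_rel (lDM DM A) (rDM DM A B) R
}.

Section Adequacy.
Variables (k : nat) (tau : vocabulary) (V : finType) (A : structure tau V).
Hypothesis arity_gt0 : forall R : tau, 0 < arity R.

Lemma scope_neq0 (f : fact tau V) : scope f != set0.
Proof.
case: f => R t; apply/set0Pn; exists (tnth t (Ordinal (arity_gt0 R))).
by rewrite inE mem_tnth.
Qed.

Lemma hw_adequate : 0 < k -> adequate (hw k) A.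
Proof.
move=> k0; have vE (C : hw_voc k A) : interp (hw_l k A) C = [set in_tuple (hw_seq C)].
  have [t tE] := @hw_views k _ _ A C; rewrite -[hw_l k A]/(lDM (hw k) A) tE; congr [set _].
  have : in_tuple (hw_seq C) \in interp (lDM (hw k) A) C by rewrite inE; apply: imset_f.
  by rewrite tE inE => /eqP.
have vvE (C : hw_voc k A) : view_vars (hw_l k A) C = vars (val C).
  rewrite (view_varsE (vE C)); apply/setP => x; rewrite inE.
  apply/flattenP/bigcupP => [[s /mapP[f fC ->] xf]|[f fC xf]].
    by exists f; [rewrite mem_enum in fC | rewrite inE].
  exists (tval (tagged f)); last by rewrite inE in xf.
  by apply/mapP; exists f; rewrite ?mem_enum.
split=> //.
- exact: hw_views.
- move=> C; rewrite vvE; have /andP[_ /andP[C0 _]] := valP C.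
  rewrite card_gt0 in C0; have /set0Pn[f fC] := C0; have /set0Pn[x xf] := scope_neq0 f.
  by apply/set0Pn; exists x; apply/bigcupP; exists f.
- move=> f fA.
  (* The base view of [f] is the view of the singleton [[set f]], available because [k] is
     positive. *)
  have Cp : ([set f] \subset facts A) && (0 < #|[set f]| <= k).
    by rewrite sub1set fA cards1.
  exists (Sub [set f] Cp : hw_symbol k A); first by rewrite vvE SubK /vars big_set1.
  move=> W B h /(view_relP _ _ (vE _))[dh [u]].
  rewrite inE => /exists_inP[h' /solutionsP[_ _ /(_ f)]]; rewrite SubK inE eqxx => /(_ isT).
  move=> sat h'u hu; rewrite -(eq_satisfies _ (h := h')) // => x xf.
  apply: maps_agree h'u hu _ _; apply/flattenP; exists (tval (tagged f)); last by rewrite inE in xf.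
  by apply/mapP; exists f; rewrite ?mem_enum ?SubK ?inE.
move=> W B C /=; apply/subsetP => h /solutionsP[dh hB sat].
have [u hu] : exists u : (size (hw_seq C)).-tuple W, maps h (in_tuple (hw_seq C)) u.
  by apply: maps_tuple => x; rewrite dh (view_varsE (vE C)) inE.
apply/(view_relP _ _ (vE C)); split=> //; exists u => //; rewrite inE.
apply/exists_inP; exists h => //; apply/solutionsP; split=> // [|f fC]; first by rewrite dh.
apply: sat; rewrite inE vvE; have /andP[/subsetP CA _] := valP C.
by rewrite CA //=; exact: (bigcup_sup f).
Qed.

Lemma tw_adequate : adequate (tw k) A.
Proof.
have vE (R : tw_voc k A) : interp (tw_l k A) R = [set tw_tuple R].
  have [t tE] := @tw_views k _ _ A R; rewrite -[tw_l k A]/(lDM (tw k) A) tE; congr [set _].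
  have : tw_tuple R \in interp (lDM (tw k) A) R by rewrite inE; apply: imset_f.
  by rewrite tE inE => /eqP.
have vvE (R : tw_voc k A) : view_vars (tw_l k A) R =
    match R with inl X => val X | inr f => scope (val f) end.
  rewrite (view_varsE (vE R)); apply/setP => x; rewrite inE.
  by case: R => [X|f]; rewrite /= ?mem_enum ?inE.
split=> //.
- exact: tw_views.
- move=> [X|f]; rewrite vvE; last exact: scope_neq0.
  by have /andP[_ /andP[X0 _]] := valP X; rewrite card_gt0 in X0.
- move=> f fA; exists (inr (Sub f fA) : tw_symbol k A); first by rewrite vvE SubK.
  move=> W B h /(view_relP _ _ (vE _))[dh [u]]; rewrite inE /= => uB hu.
  by apply/exists_inP; exists u; rewrite ?inE.
move=> W B R /=; apply/subsetP => h /solutionsP[dh hB sat].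
have sub : {subset tw_tuple R <= dom h} by move=> x; rewrite dh (view_varsE (vE R)) inE.
apply/(view_relP _ _ (vE R)); split=> //.
rewrite vvE in dh sat; case: R dh sat sub => [X|[f fA]] dh sat sub.
  have [u hu] := maps_tuple sub; exists u => //; rewrite inE.
  by apply/exists_inP; exists h => //; apply/solutionsP.
have /exists_inP[u] : satisfies B h f by apply: sat; rewrite inE fA /=.
by rewrite inE => uB hu; exists u; rewrite // inE.
Qed.

End Adequacy.

(** * From tree projections to arc consistency *)

Section Forward.
Variables (DM : method) (tau : vocabulary) (V : finType) (A : structure tau V).
Hypothesis DM_ad : adequate DM A.
Let AV := lDM DM A.
Let AV_views : is_view_structure AV := ad_views DM_ad.
Local Notation vv := (view_vars AV).

Lemma view_vars_sub_univ R : vv R \subset univ A.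
Proof. by rewrite -(ad_lunivE DM_ad); exact: view_vars_univ. Qed.

Section Target.
Variables (W : finType) (B : structure tau W).
Let BV := rDM DM A B.
Local Notation gac := (view_rel AV (GAC AV BV)).

(** The restrictions of the solutions to the views form an arc consistent family. *)
Lemma homs_sub_GAC R h : h \in homs A B -> restrict (vv R) h \in gac R.
Proof.
move=> hA; pose S R := [set restrict (vv R) h | h in homs A B].
apply: (subsetP (sub_GAC AV_views (S := S) _ _ R)); last exact: imset_f.
- move=> R1; apply/subsetP => _ /imsetP[h1 /solutionsP[dh hB sat] ->].
  apply: (subsetP (ad_solutions DM_ad B R1)); apply/solutionsP; split.
  + by rewrite dom_restrict // dh; exact: view_vars_sub_univ.
  + by move=> x b; rewrite ffunE; case: ifP => // _; exact: hB.
  move=> f; rewrite inE => /andP[fA fR]; rewrite (eq_satisfies _ (h' := h1)) ?sat //.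
  by move=> x /(subsetP fR) xR; rewrite restrictE.
move=> R1 R2 _; apply/subsetP => _ /imsetP[_ /imsetP[h1 h1A ->] ->].
apply/imsetP; exists (restrict (vv R2) h1); first exact: imset_f.
by apply: eq_restrict => x /setIP[x1 x2]; rewrite !restrictE.
Qed.

Hypothesis A_connected : hyp_connected (hyp A).

(** Nonemptiness passes between views sharing a variable. Connectedness gives a path from a variable
    of [R] to one of [R'], each step of which lies in a base view. *)
Lemma GAC_inhabited R R' h : h \in gac R -> exists h', h' \in gac R'.
Proof.
move=> hR; have /set0Pn[x xR] := ad_neq0 DM_ad R; have /set0Pn[y yR] := ad_neq0 DM_ad R'.
have /connectP[p] := A_connected (subsetP (view_vars_sub_univ R) x xR)
  (subsetP (view_vars_sub_univ R') y yR).
have hx R1 : x \in vv R1 -> exists h1, h1 \in gac R1.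
  move=> xR1; have [|h1 h1R _] := GAC_agree AV_views (R' := R1) hR; last by exists h1.
  by apply/set0Pn; exists x; rewrite inE xR.
elim: p x hx {xR} => [|z p IHp] x hx /=; first by move=> _ yx; apply: hx; rewrite -yx.
move=> /andP[/exists_inP[_ /imsetP[f fA ->] /andP[xf zf]] zp]; apply: IHp zp => R1 zR1.
have [R2 R2f _] := ad_base DM_ad fA.
have [|h2 h2R] := hx R2; first by rewrite R2f.
have [|h1 h1R _] := GAC_agree AV_views (R' := R1) h2R; last by exists h1.
by apply/set0Pn; exists z; rewrite inE R2f zf.
Qed.

(** Arc consistency compares only views with a common variable; for disjoint ones any tuple of [R']
    will do, and connectedness provides one. *)
Lemma GAC_extend R R' h : h \in gac R ->
  exists2 h', h' \in gac R' & {in vv R :&: vv R', h =1 h'}.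
Proof.
move=> hR; have [X0|X0] := eqVneq (vv R :&: vv R') set0; last exact: GAC_agree.
have [h' h'R] := GAC_inhabited R' hR; exists h' => // x.
by rewrite X0 inE.
Qed.

Lemma GAC_satisfies R h f :
  h \in gac R -> f \in facts A -> scope f \subset vv R -> satisfies B h f.
Proof.
move=> hR fA /subsetP fR; have [R' R'f baseR'] := ad_base DM_ad fA.
have [h' h'R hh'] := GAC_extend R' hR.
rewrite (eq_satisfies _ (h' := h')); last first.
  by move=> x xf; apply: hh'; rewrite inE R'f xf fR.
by apply: baseR'; apply: (subsetP (GAC_sub _ _ _)) h'R.
Qed.

Lemma GAC_hom (O : {set V}) R h : O \subset univ A -> tp_covered A AV O ->
  O \subset vv R -> h \in gac R ->
  exists2 g, g \in homs A B & {in O, g =1 h}.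
Proof.
move=> OA [A' [[/andP[_ /subsetP sA'] [r /solutionsP[dr _ rA']] _]]].
move=> [Ha [[e jt] le1 le2]] OR hR.
(* The relation of [R_O] has a single tuple, so [r] sends it to itself and fixes [O] pointwise. The
   tuple thus survives in the core and yields a hyperedge containing [O]. *)
have rO x : x \in O -> r x = Some x /\ exists2 h1, h1 \in hedges (hyp A') & O \subset h1.
  move=> xO; have O0 : O != set0 by apply/set0Pn; exists x.
  pose R0 : voc_union tau (voc_O O) := inr tt.
  have fA : @mkfact _ _ R0 (enum_tuple O) \in facts (str_union A (S_ O)).
    by rewrite inE /= /S_facts (negPf O0) inE eqxx.
  have /exists_inP[u] := rA' _ fA; rewrite inE => uA' ru.
  have := sA' _ uA'; rewrite inE /= /S_facts (negPf O0) inE => /eqP E.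
  have {E} uE : u = enum_tuple O.
    by apply/eqP; have /eqP := E; rewrite -tag_eqE /tag_eq /= tagged_asE.
  split; last first.
    exists (scope (mkfact u)); first exact: imset_f.
    by apply/subsetP => y yO; rewrite inE uE /= mem_enum.
  have /eqP : maps r (enum O) (enum O) by have := ru; rewrite uE.
  by move/eq_in_map => ->; rewrite // mem_enum.
(* The local condition to be glued: on [s], the assignment agrees with an arc consistent tuple of a
   view containing [s]. *)
pose Q (s : {set V}) (g : V -> option W) := exists R1 h1,
  [/\ s \subset vv R1, h1 \in gac R1 & {in s, h1 =1 g}].
have Qext (s : {set V}) g g' : {in s, g =1 g'} -> Q s g -> Q s g'.
  by move=> gg' [R1 [h1 [? ? E]]]; exists R1, h1; split=> // x xs; rewrite E ?gg'.
have Qstep (s s' : {set V}) g : s \in hedges Ha -> s' \in hedges Ha -> Q s g ->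
    exists2 g', Q s' g' & {in s :&: s', g =1 g'}.
  move=> _ s'H [R1 [h1 [sR1 h1R E1]]].
  have [_ /(hyp_viewsP AV_views)[R2 ->] s'R2] := le2 _ s'H.
  have [h2 h2R E2] := GAC_extend R2 h1R; exists h2; first by exists R2, h2.
  move=> x /setIP[xs xs']; rewrite -E1 // E2 // inE.
  by rewrite (subsetP sR1) // (subsetP s'R2).
have [g Qg gO] : exists2 g, forall s, s \in hedges Ha -> Q s g &
    {in O, forall x, x \in cover (hedges Ha) /\ g x = h x}.
  have [[s0 s0H Os0]|[Ha0 O0]] : (exists2 s0, s0 \in hedges Ha & O \subset s0) \/
      (hedges Ha = set0 /\ O = set0).
    have [O0|/set0Pn[x xO]] := eqVneq O set0.
      have [->|/set0Pn[s0 s0H]] := eqVneq (hedges Ha) set0; first by right.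
      by left; exists s0; rewrite // O0 sub0set.
    have [_ [h1 h1A' Oh1]] := rO x xO; have [s0 s0H h1s0] := le1 _ h1A'.
    by left; exists s0 => //; exact: subset_trans h1s0.
  - have [_ /(hyp_viewsP AV_views)[R0 ->] s0R0] := le2 _ s0H.
    have [h0 h0R E0] := GAC_extend R0 hR.
    have Q0 : Q s0 h0 by exists R0, h0.
    have [g Qg gs0] := join_tree_glue jt Qext Qstep s0H Q0.
    exists g => // x xO; have xs0 := subsetP Os0 x xO.
    split; first by apply/bigcupP; exists s0.
    by rewrite gs0 // -E0 // inE (subsetP OR) // (subsetP s0R0).
  - by exists (fun _ => None) => x; rewrite ?Ha0 ?O0 inE.
(* Variables in no hyperedge of the tree projection are sent to an arbitrary [b0], so that the
   composite with [r] is total on the universe. *)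
have [b0 b0B] : exists b0, b0 \in univ B.
  have /set0Pn[x xR] := ad_neq0 DM_ad R.
  rewrite -(view_rel_dom AV_views hR) inE in xR; case hx: (h x) xR => [b|//] _.
  exists b; rewrite -(ad_runivE DM_ad B).
  exact: (view_rel_univ AV_views (subsetP (GAC_sub _ _ _) _ hR) hx).
pose g' y := if y \in cover (hedges Ha) then g y else Some b0.
have g'B y : exists2 b, g' y = Some b & b \in univ B.
  rewrite /g'; case: ifP => [/bigcupP[s sH ys]|_]; last by exists b0.
  have [R1 [h1 [sR1 h1R E1]]] := Qg s sH; rewrite -E1 //.
  have : y \in dom h1 by rewrite (view_rel_dom AV_views h1R) (subsetP sR1).
  rewrite inE; case hy: (h1 y) => [b|//] _; exists b => //.
  rewrite -(ad_runivE DM_ad B).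
  exact: (view_rel_univ AV_views (subsetP (GAC_sub _ _ _) _ h1R) hy).
exists [ffun x => if x \in univ A then obind g' (r x) else None].
  apply/solutionsP; split.
  - apply/setP => x; rewrite inE ffunE; case: ifP => // xA.
    have : x \in dom r by rewrite dr inE xA.
    by rewrite inE; case: (r x) => //= y _; have [b ->] := g'B y.
  - move=> x b; rewrite ffunE; case: ifP => // _; case: (r x) => //= y.
    by have [b' -> b'B] := g'B y; case=> <-.
  (* The image of a constraint under [r] is a constraint of the core, hence lies in a hyperedge of
     the tree projection and so in a view, whose tuples satisfy it. *)
  move=> [R1 t] fA.
  have /(rA' _)/exists_inP[u] : @mkfact (voc_union tau (voc_O O)) V (inl R1) t
      \in facts (str_union A (S_ O)) by rewrite inE.
  rewrite inE => uA' /eqP rtu.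
  have fuA : @mkfact tau V R1 u \in facts A by have := sA' _ uA'; rewrite inE.
  have [s sH us] := le1 _ (imset_f (@scope _ _) uA').
  have [R2 [h2 [sR2 h2R E2]]] := Qg s sH.
  have /exists_inP[w wB /eqP uw] := GAC_satisfies h2R fuA (subset_trans us sR2).
  apply/exists_inP; exists w => //; rewrite /maps -uw.
  have -> : [seq h2 y | y <- tagged (mkfact u)] = [seq g' y | y <- u].
    apply/eq_in_map => y yu; have ys : y \in s by apply: (subsetP us); rewrite inE.
    by rewrite E2 // /g'; case: ifP => // /bigcupP[]; exists s.
  have -> : [seq g' y | y <- u] = [seq obind g' y | y <- [seq Some y | y <- u]].
    by rewrite -map_comp.
  rewrite -rtu -map_comp; apply/eqP/eq_in_map => x xt; rewrite ffunE.
  have -> // : x \in univ A.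
  by apply: (subsetP (scope_univ fA)); rewrite inE.
move=> x xO; rewrite ffunE (subsetP OA) //; have [-> _] := rO x xO.
by rewrite /= /g'; have [-> ->] := gO x xO.
Qed.
End Target.
End Forward.

(** * From arc consistency to tree projections *)

Section Images.
Variable tau : vocabulary.

Definition map_fact (V W : finType) (g : V -> W) (f : fact tau V) : fact tau W :=
  mkfact (map_tuple g (tagged f)).

Lemma scope_map_fact (V W : finType) (g : V -> W) (f : fact tau V) :
  scope (map_fact g f) = g @: scope f.
Proof.
apply/setP => y; rewrite inE; apply/mapP/imsetP => -[x xt ->]; exists x => //;
  by rewrite inE in xt *.
Qed.

Variable V : finType.
Implicit Types A S : structure tau V.

Lemma image_wf (g : V -> V) S :
  [forall f in map_fact g @: facts S, scope f \subset g @: univ S].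
Proof.
apply/forall_inP => _ /imsetP[f fS ->]; rewrite scope_map_fact.
exact/imsetS/scope_univ.
Qed.

Definition image_structure (g : V -> V) S : structure tau V := Structure (image_wf g S).

Lemma structure_eq S S' : univ S = univ S' -> facts S = facts S' -> S = S'.
Proof.
case: S S' => [U F w] [U' F' w'] /= EU EF; case: U' / EU w'; case: F' / EF => w'.
by congr Structure; exact: bool_irrelevance.
Qed.

Definition size_structure S := #|univ S| + #|facts S|.

Definition receives A S := substructure S A && [exists h, h \in homs A S].

(** Minimality is measured by size rather than inclusion, so that it carries over to images under
    endomorphisms. *)
Definition minimal_image A S :=
  receives A S /\ forall S', receives A S' -> size_structure S <= size_structure S'.

Lemma induced_wf (U : {set V}) (F : {set fact tau V}) :
  [forall f in [set f in F | scope f \subset U], scope f \subset U].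
Proof. by apply/forall_inP => f; rewrite inE => /andP[]. Qed.

(* By [induced_id] every structure is induced by a pair in a finite type, so that
   one of minimal size can be selected. *)
Definition induced (p : {set V} * {set fact tau V}) : structure tau V :=
  Structure (induced_wf p.1 p.2).

Lemma induced_id S : induced (univ S, facts S) = S.
Proof.
apply: structure_eq => //=; apply/setP => f; rewrite inE.
by case fS: (f \in facts S); rewrite //= scope_univ.
Qed.

Lemma homs_id A : [ffun x => if x \in univ A then Some x else None] \in homs A A.
Proof.
apply/solutionsP; split.
- by apply/setP => x; rewrite inE ffunE; case: ifP.
- by move=> x b; rewrite ffunE; case: ifP => // xA [<-].
move=> [R t] fA; apply/exists_inP; exists t; first by rewrite inE.
apply/eqP/eq_in_map => x xt; rewrite ffunE.
by have -> : x \in univ A by apply: (subsetP (scope_univ fA)); rewrite inE.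
Qed.

Lemma minimal_image_exists A : exists S, minimal_image A S.
Proof.
have A0 : receives A (induced (univ A, facts A)).
  rewrite induced_id /receives /substructure !subxx /=.
  by apply/existsP; eexists; exact: homs_id.
have [p pA pmin] := @arg_minnP _ (univ A, facts A) (fun p => receives A (induced p))
  (fun p => size_structure (induced p)) A0.
exists (induced p); split=> // S' S'A; rewrite -(induced_id S').
by apply: pmin; rewrite induced_id.
Qed.

Lemma minimal_image_core A S : minimal_image A S -> is_core S A.
Proof.
case=> /andP[SA /existsP hom] Smin; split=> // S' /andP[U F] hom'.
have : size_structure S <= size_structure S'.
  apply: Smin; case/andP: SA => SU SF; rewrite /receives /substructure.
  by rewrite (subset_trans U SU) (subset_trans F SF); apply/existsP.
rewrite /size_structure; have := subset_leq_card U; have := subset_leq_card F.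
move=> cF cU cS; apply: structure_eq; apply/eqP; rewrite eqEcard ?U ?F /=.
  by rewrite -(leq_add2r #|facts S|); apply: leq_trans cS _; rewrite leq_add2l.
by rewrite -(leq_add2l #|univ S|); apply: leq_trans cS _; rewrite leq_add2r.
Qed.

Lemma image_hom A S (g : V -> V) h :
  h \in homs A S -> [ffun x => omap g (h x)] \in homs A (image_structure g S).
Proof.
move=> /solutionsP[dh hS sat]; apply/solutionsP; split.
- by rewrite -dh; apply/setP => x; rewrite !inE ffunE; case: (h x).
- move=> x b; rewrite ffunE; case E: (h x) => [y|] //= [<-].
  by apply: imset_f; exact: hS E.
move=> [R t] /sat/exists_inP[u uS /eqP hu]; apply/exists_inP; exists (map_tuple g u).
  by rewrite inE; apply/imsetP; exists (mkfact u) => //; rewrite inE in uS.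
apply/eqP; rewrite /= -map_comp.
have -> : [seq (Some \o g) y | y <- u] = [seq omap g z | z <- [seq Some y | y <- u]].
  by rewrite -map_comp.
by rewrite -hu -map_comp; apply/eq_map => x; rewrite ffunE.
Qed.

(** The image also receives a homomorphism from [A] and is no larger than [S]. By minimality the
    sizes agree, so no two elements are identified. *)
Lemma image_minimal A S (g : V -> V) :
  minimal_image A S -> substructure (image_structure g S) A ->
  minimal_image A (image_structure g S) /\ {in univ S &, injective g}.
Proof.
case=> /andP[SA /existsP[h hS]] Smin sub.
have recv : receives A (image_structure g S).
  by rewrite /receives sub; apply/existsP; eexists; exact: image_hom hS.
have := Smin _ recv; rewrite /size_structure /=.
have cU := leq_imset_card g (univ S); have cF := leq_imset_card (map_fact g) (facts S).
move=> le; split; first split=> // S' /Smin; rewrite /size_structure /=.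
  by apply: leq_trans; exact: leq_add.
apply/imset_injP; rewrite eqn_leq cU /= -(leq_add2r #|facts S|).
by apply: leq_trans le _; rewrite leq_add2l.
Qed.

End Images.

(** * The finite unfolding of a left-hand structure *)

Section Backward.
Variables (DM : method) (tau : vocabulary) (V : finType) (A : structure tau V).
Hypothesis DM_ad : adequate DM A.
Let AV := lDM DM A.
Let AV_views : is_view_structure AV := ad_views DM_ad.
Local Notation vv := (view_vars AV).

(** Elimination needs more levels than there are variables, hence the depth [N]; the palette size
    [M] always leaves a fresh colour at that depth. *)
Let N := #|V|.+1.
Let M := palette_size V N.+1.
Let view_sets : {set {set V}} := [set vv R | R : voc_views DM A].
Local Notation label := (history V M N).
Local Notation coherent := (coherent (M := M) view_sets).

Definition pairing (b : V -> label) (x : V) : V * label := (x, b x).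

(** The finite quotient of the tree-like gluing: a constraint is lifted along every coherent
    labelling of its scope. *)
Definition unfolding_facts : {set fact tau (V * label)%type} :=
  [set g | [exists f in facts A, exists b : {ffun V -> label},
     coherent (scope f) b && (g == map_fact (pairing b) f)]].

Lemma unfolding_wf : [forall g in unfolding_facts,
  scope g \subset [set w : V * label | w.1 \in univ A]].
Proof.
apply/forall_inP => g; rewrite inE => /exists_inP[f fA /existsP[b /andP[_ /eqP->]]].
rewrite scope_map_fact; apply/subsetP => _ /imsetP[x xf ->]; rewrite inE.
exact: (subsetP (scope_univ fA)).
Qed.

Definition unfolding : structure tau (V * label)%type := Structure unfolding_wf.

Definition section_on (X : {set V}) (b : V -> label) : assignment V (V * label)%type :=
  [ffun x => if x \in X then Some (x, b x) else None].

Lemma dom_section_on X b : dom (section_on X b) = X.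
Proof. by apply/setP => x; rewrite inE ffunE; case: ifP. Qed.

(** Coherent labellings of the views form an arc consistent family: one restricted to the common
    variables of two views extends to the second view with a fresh colour. *)
Lemma section_GAC R (b : {ffun V -> label}) : coherent (vv R) b ->
  section_on (vv R) b \in view_rel AV (GAC AV (rDM DM A unfolding)) R.
Proof.
pose S R := [set section_on (vv R) b | b : {ffun V -> label} & coherent (vv R) b].
move=> cb; apply: (subsetP (sub_GAC AV_views (S := S) _ _ R)); last first.
  by apply: imset_f; rewrite inE.
- move=> R1 R2 _; apply/subsetP => _ /imsetP[_ /imsetP[b1 + ->] ->]; rewrite inE => cb1.
  set Y := vv R1 :&: vv R2.
  have cY : coherent Y b1 by apply: coherentW cb1; exact: subsetIl.
  have [c cN] := fresh_color b1 (leqnn M).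
  have R2v : vv R2 \in view_sets by exact: imset_f.
  have cE := coherent_extend (subsetIr _ _) R2v cY (fun y _ => cN y).
  apply/imsetP; exists (section_on (vv R2) (finfun (extend (vv R2) Y b1 c))).
    apply: imset_f; rewrite inE; apply: coherent_eq cE => y _; by rewrite ffunE.
  apply: eq_restrict => x xY; rewrite !ffunE /extend xY.
  by have /setIP[-> ->] := xY.
move=> R1; apply/subsetP => _ /imsetP[b1 + ->]; rewrite inE => cb1.
apply: (subsetP (ad_solutions DM_ad unfolding R1)); apply/solutionsP; split.
- exact: dom_section_on.
- move=> x p; rewrite ffunE; case: ifP => // xR [<-]; rewrite inE.
  exact: (subsetP (view_vars_sub_univ DM_ad R1)).
move=> f; rewrite inE => /andP[fA fR]; apply/exists_inP.
exists (map_tuple (pairing b1) (tagged f)).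
  rewrite !inE; apply/exists_inP; exists f => //; apply/existsP; exists b1.
  by rewrite (coherentW fR cb1) eqxx.
apply/eqP; rewrite -map_comp; apply/eq_in_map => x xf.
by rewrite ffunE (subsetP fR) // inE.
Qed.

Lemma view_set_coherent R : exists b : {ffun V -> label}, coherent (vv R) b.
Proof.
have inh n : exists d : history V M n, true.
  have M0 : 0 < M by [].
  elim: n => [|n [d _]]; first by exists tt.
  by exists (set0, [ffun=> None], Ordinal M0).
have [d _] := inh N; have [c cN] := fresh_color (fun=> d) (leqnn M).
have Rv : vv R \in view_sets by exact: imset_f.
have c0 : coherent set0 (fun=> d) by apply/coherentS => x; rewrite inE.
have cE := coherent_extend (sub0set _) Rv c0 (fun y _ => cN y).
by exists (finfun (extend (vv R) set0 (fun=> d) c)); apply: coherent_eq cE => y _; rewrite ffunE.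
Qed.

Variable O : {set V}.
Let AO := str_union A (S_ O).

Lemma S_scope (t : #|O|.-tuple V) : @mkfact (voc_O O) V tt t \in S_facts O ->
  O != set0 /\ t = enum_tuple O.
Proof.
rewrite /S_facts; case: ifP => [_|O0]; rewrite inE // => /eqP E; split=> //.
by apply/eqP; have /eqP := E; rewrite -tag_eqE /tag_eq /= tagged_asE.
Qed.

(* The first components of a homomorphism to the unfolding form an endomorphism
   of [AO]; a core mapped by it is mapped isomorphically, and the second
   components then label its image coherently. *)
Lemma unfolding_hom_tp_covered R h (b : {ffun V -> label}) :
  h \in homs A unfolding -> O \subset vv R -> coherent (vv R) b ->
  {in O, h =1 section_on (vv R) b} -> tp_covered A AV O.
Proof.
move=> /solutionsP[dh hA sat] OR cb hO.
pose p x := if h x is Some w then w.1 else x.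
pose d x := if h x is Some w then w.2 else b x.
have pO x : x \in O -> p x = x /\ d x = b x.
  by move=> xO; rewrite /p /d hO // ffunE (subsetP OR).
have pA (f : fact tau V) : f \in facts A -> map_fact p f \in facts A /\
    exists2 b', coherent (scope (map_fact p f)) b' & {in scope f, forall x, d x = b' (p x)}.
  move=> fA; have /exists_inP[u] := sat f fA; rewrite !inE.
  move=> /exists_inP[f' f'A /existsP[b' /andP[cb' /eqP E]]] hu.
  case: f fA u hu E => S t fA u hu E.
  case: f' f'A cb' E => S' t' f'A cb' E.
  have ES : S = S' by have := congr1 tag E.
  case: S' / ES t' f'A cb' E => t' f'A cb' E.
  have {E} uE : u = map_tuple (pairing b') t'.
    by apply/eqP; have /eqP := E; rewrite -tag_eqE /tag_eq /= eqxx /= tagged_asE.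
  have hi i : h (tnth t i) = Some (pairing b' (tnth t' i)).
    have E : map_tuple h t = map_tuple (Some \o pairing b') t'.
      by apply/val_inj; have /eqP := hu; rewrite uE /= -map_comp.
    by have := congr1 (fun s => tnth s i) E; rewrite !tnth_map.
  have ptE : map_tuple p t = t'.
    by apply: eq_from_tnth => i; rewrite tnth_map /p hi.
  have fE : map_fact p (mkfact t) = mkfact t' by rewrite /map_fact /= ptE.
  rewrite -[existT _ S t]/(mkfact t) fE; split=> //; exists b' => // x.
  by rewrite inE => /tnthP[i ->]; rewrite /p /d hi.
have [S0 S0min] := minimal_image_exists AO.
have S0A : substructure S0 AO by case: S0min => /andP[].
have [/subsetP U0 /subsetP F0] := andP S0A.
have AO_O x : x \in O -> @mkfact (voc_union tau (voc_O O)) V (inr tt) (enum_tuple O) \in facts AO.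
  move=> xO; have O0 : O != set0 by apply/set0Pn; exists x.
  by rewrite inE /= /S_facts (negPf O0) inE eqxx.
have S0O : O \subset univ S0.
  apply/subsetP => x xO; case: S0min => /andP[_ /existsP[r /solutionsP[_ _ rsat]]] _.
  have /exists_inP[[u su]] := rsat _ (AO_O x xO); rewrite inE => uS _.
  have [_ uE] : O != set0 /\ Tuple su = enum_tuple O.
    by apply: S_scope; have := F0 _ uS; rewrite inE.
  by apply: (subsetP (scope_univ uS)); rewrite uE inE /= mem_enum.
have pAO : substructure (image_structure p S0) AO.
  have pF (f : fact (voc_union tau (voc_O O)) V) : f \in facts AO -> map_fact p f \in facts AO.
    case: f => [[T|[]] t] fA.
      have /pA[pfA _] : @mkfact tau V T t \in facts A by rewrite inE in fA.
      by rewrite inE.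
    have /S_scope[_ tE] : @mkfact (voc_O O) V tt t \in S_facts O by rewrite inE in fA.
    suff ptE : map_tuple p t = t by rewrite /map_fact /= ptE.
    rewrite tE; apply/val_inj; rewrite /= -[RHS]map_id; apply/eq_in_map => x.
    by rewrite mem_enum => /pO[].
  apply/andP; split; apply/subsetP; last by move=> _ /imsetP[f fS ->]; exact/pF/F0.
  move=> _ /imsetP[x xS ->]; have := U0 x xS; rewrite !inE => /orP[xA|xO].
    rewrite -dh inE in xA; rewrite /p; case E: (h x) xA => [w|//] _.
    by have := hA _ _ E; rewrite inE => ->.
  by have [-> _] := pO x xO; rewrite xO orbT.
have [Smin pinj] := image_minimal S0min pAO.
pose S1 := image_structure p S0.
exists S1; split; first exact: minimal_image_core.
(* Labels are carried to the image of the core along the inverse of [p], which is injective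
   there. *)
pose d1 y := if [pick x in univ S0 | p x == y] is Some x then d x else d y.
have d1p x : x \in univ S0 -> d1 (p x) = d x.
  move=> xS; rewrite /d1; case: pickP => [x' /andP[x'S /eqP /pinj -> //]|/(_ x)].
  by rewrite xS eqxx.
have [||E [jt cov sm]] :=
  @coherent_tree_projection V view_sets M N [set scope f | f in facts S1] d1.
(* A hyperedge from a constraint lies in its base view and is labelled as in the unfolding. The one
   from [R_O] is [O] itself, contained in [R] and labelled by [b]. *)
- move=> _ /imsetP[_ /imsetP[f fS ->] ->].
  case: f fS => [[T|[]] t] fS.
    have fA : @mkfact tau V T t \in facts A by have := F0 _ fS; rewrite inE.
    have [pfA [b' cb' db']] := pA _ fA.
    have [R1 R1f _] := ad_base DM_ad pfA.
    split; last by exists (vv R1); [exact: imset_f | rewrite R1f].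
    apply: coherent_eq cb' => y; rewrite scope_map_fact => /imsetP[x xt ->].
    by rewrite d1p ?db' //; apply: (subsetP (scope_univ fS)).
  have [_ tE] : O != set0 /\ t = enum_tuple O.
    by apply: S_scope; have := F0 _ fS; rewrite inE.
  have scE : scope (map_fact p (@mkfact (voc_union tau (voc_O O)) V (inr tt) t)) = O.
    rewrite scope_map_fact; have -> : scope (@mkfact (voc_union tau (voc_O O)) V (inr tt) t) = O.
      by rewrite tE; apply/setP => x; rewrite inE /= mem_enum.
    rewrite -[RHS]imset_id; apply: eq_in_imset => x /pO[].
    by [].
  rewrite [scope _]scE.
  split; last by exists (vv R) => //; exact: imset_f.
  apply: (coherent_eq _ (coherentW OR cb)) => y yO; have [py dy] := pO y yO.
  by rewrite -{2}py d1p ?dy // (subsetP S0O).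
- by rewrite ltnS; exact: max_card.
exists (span E); split; first exact: jt.
- by move=> e /cov.
- move=> e /sm[_ [_ /imsetP[R1 _ ->] eR1]]; exists (vv R1) => //.
  by apply/(hyp_viewsP AV_views); exists R1.
Qed.
(** Every constraint has a base view, so without views no core has a tuple and the empty hypergraph
    is a tree projection. *)
Lemma no_view_tp_covered :
  O = set0 -> (forall R : voc_views DM A, False) -> tp_covered A AV O.
Proof.
move=> O0 noR; have [S Smin] := minimal_image_exists AO.
exists S; split; first exact: minimal_image_core.
have S0 : facts S = set0.
  have [/andP[/andP[_ /subsetP SF] _] _] := Smin.
  apply/setP => f; rewrite in_set0; apply/negP => /SF.
  case: f => [[T|[]] t]; rewrite inE; first by case/(ad_base DM_ad) => R; have := noR R.
  by case/S_scope => /eqP.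
exists (span set0); split.
- exists (fun _ _ => false); apply: join_tree_small.
  by apply/setP => x; rewrite inE; apply/bigcupP => -[h]; rewrite inE.
- by move=> e /imsetP[f]; rewrite S0 inE.
- by move=> e; rewrite inE.
Qed.

Lemma GAC_tp_covered :
  (O != set0 -> exists R, O \subset vv R) ->
  (forall (W : finType) (B : structure tau W) R, O \subset vv R ->
     proj O (view_rel AV (GAC AV (rDM DM A B)) R) \subset proj O (homs A B)) ->
  tp_covered A AV O.
Proof.
move=> O_view gac; have [[R OR]|noR] : (exists R, O \subset vv R) \/
    (O = set0 /\ forall R : voc_views DM A, False).
  have [O0|/O_view] := eqVneq O set0; last by left.
  case: (pickP (@predT (voc_views DM A))) => [R _|none]; last first.
    by right; split=> // R; have := none R.
  by left; exists R; rewrite O0 sub0set.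
(* The unfolding is the right-hand structure to test: exactness extends the restriction to [O] of an
   arc consistent tuple to a homomorphism. *)
- have [b cb] := view_set_coherent R.
  have /imsetP[h hA /restrict_agree hO] := subsetP (gac _ unfolding R OR) _
    (imset_f (restrict O) (section_GAC cb)).
  by apply: (unfolding_hom_tp_covered hA OR cb) => x xO; rewrite hO.
- by case: noR; exact: no_view_tp_covered.
Qed.

End Backward.

(** * Equivalence of tp-covering and exactness of arc consistency *)

Theorem mainTheorem1 (k : nat) (k_ge1 : 1 <= k)
  (DM : method) (DM_tw_hw : DM = tw k \/ DM = hw k)
  (tau : vocabulary) (arity_gt0 : forall R : tau, 0 < arity R)
  (V : finType) (A : structure tau V) (A_connected : hyp_connected (hyp A))
  (O : {set V}) (O_univ : O \subset univ A)
  (O_view : O != set0 ->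
     exists R : voc_views DM A, O \subset view_vars (lDM DM A) R) :
  tp_covered A (lDM DM A) O
  <->
  (forall (W : finType) (B : structure tau W) (R : voc_views DM A),
     O \subset view_vars (lDM DM A) R ->
     proj O (view_rel (lDM DM A) (GAC (lDM DM A) (rDM DM A B)) R)
     = proj O (homs A B)).
Proof.
have DM_ad : adequate DM A.
  by case: DM_tw_hw => ->; [exact: tw_adequate | exact: hw_adequate].
split=> [tpO W B R OR|gac].
  apply/eqP; rewrite eqEsubset; apply/andP; split; apply/subsetP => _ /imsetP[h hR ->].
    have [g gA gh] := GAC_hom DM_ad A_connected O_univ tpO OR hR.
    by rewrite -(eq_restrict gh); exact: imset_f.
  have -> : restrict O h = restrict O (restrict (view_vars (lDM DM A) R) h).
    by apply: eq_restrict => x xO; rewrite restrictE // (subsetP OR).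
  exact: imset_f (homs_sub_GAC DM_ad R hR).
apply: (GAC_tp_covered DM_ad) => // W B R OR.
by rewrite (gac W B R OR).
Qed.
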